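(* Let $(G_i,M_i,N_i)$ be triples of groups, for $i=1,2$. Then $$ M(G_1 \ast G_2,\langle M_1\ast M_2\rangle^{G_1\ast G_2},\langle N_1\ast N_2\rangle^{G_1\ast G_2})\cong M(G_1,M_1,N_1)\oplus M(G_2,M_2,N_2).$$
   Context: A triple of groups $(G,M,N)$ is a group $G$ with two normal subgroups $M,N$. $G_1*G_2$ is the free product, and $\langle X\rangle^{G_1*G_2}$ denotes the normal closure of $X$ in $G_1*G_2$. $M(G,M,N)$ denotes the Schur multiplier of the triple $(G,M,N)$, i.e. the Baer invariant $\mathcal{V}M(G,M,N)$ for $\mathcal{V}$ the variety of abelian groups. Explicitly: a simplicial group $K_.$ is free if each $K_n$ is a free group with a basis such that all degeneracies send the basis of $K_n$ into the basis of $K_{n+1}$; a free simplicial resolution of $G$ is a free simplicial group $K_.$ with $\pi_0(K_.)=G$ and $\pi_n(K_.)=0$ for $n\ge1$. Take free simplicial resolutions $K_.,L_.,R_.,S_.$ of $G$, $G/N$, $G/M$, $G/MN$, respectively, and a commutative square of simplicial homomorphisms $\alpha:K_.\to L_.$, $\beta:K_.\to R_.$, $\gamma:R_.\to S_.$, $\delta:L_.\to S_.$ (with $\gamma\beta=\delta\alpha$) inducing the natural projections on $\pi_0$, such that the induced maps between the degreewise abelianizations $K_.^{ab},L_.^{ab},R_.^{ab},S_.^{ab}$ are surjective, and the induced maps $\ker(K_.^{ab}\to L_.^{ab})\to\ker(R_.^{ab}\to S_.^{ab})$ and $\ker(K_.^{ab}\to R_.^{ab})\to\ker(L_.^{ab}\to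 S_.^{ab})$ are surjective. Then $M(G,M,N):=\pi_1\big(\ker\big(\ker(K_.^{ab}\to L_.^{ab})\to\ker(R_.^{ab}\to S_.^{ab})\big)\big)$. *)

(* Defs.v *)
(* Groups are the possibly infinite [groupType]s of monoid.v. Subsets are
   boolean predicates, membership being decided classically (boolp). *)
From Stdlib Require Import Relation_Operators.
From HB Require Import structures.
From mathcomp Require Import all_boot boolp.

Set Implicit Arguments.
Unset Strict Implicit.
Unset Printing Implicit Defensive.

Local Open Scope group_scope.
Local Open Scope quotient_scope.

Notation "{ 'ghom' G -> H }" := (UMagmaMorphism.type G%type H%type)
  (at level 0, G at level 98, H at level 99, format "{ 'ghom'  G  ->  H }")
  : type_scope.

Definition group_iso (G H : groupType) : Prop := exists f : {ghom G -> H}, bijective f.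

Definition surjective (A B : Type) (f : A -> B) : Prop :=
  forall y, exists x, f x = y.

HB.mixin Record isConjClosed (G : groupType) (S : {pred G}) := {
  gpred_conj : forall x y, x \in S -> x ^ y \in S
}.

#[short(type="normalClosed")]
HB.structure Definition NormalClosed G :=
  {S of isConjClosed G S & GroupClosed G S}.

Record subgrp (G : groupType) (S : groupClosed G) :=
  Subgrp { sgval : G; sgvalP : sgval \in S }.

Section Subgrp.
Variables (G : groupType) (S : groupClosed G).

HB.instance Definition _ := [isSub for @sgval G S].
HB.instance Definition _ := [Choice of subgrp S by <:].

Fact subgrp_closed : group_closed S.
Proof. by split=> [|x y Sx Sy]; rewrite ?gpred1 // gpredM // gpredVr. Qed.

HB.instance Definition _ :=
  SubChoice_isSubGroup.Build G _ (subgrp S) subgrp_closed.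

Lemma sgval1 : sgval (1 : subgrp S) = 1.
Proof. exact: (val1 (subgrp S)). Qed.

Lemma sgvalM (x y : subgrp S) : sgval (x * y) = sgval x * sgval y.
Proof. exact: (valM x y). Qed.

Lemma sgvalV (x : subgrp S) : sgval x^-1 = (sgval x)^-1.
Proof. exact: (gmulfV (val : subgrp S -> G)). Qed.

End Subgrp.

Section Quotient.
Variables (G : groupType) (N : normalClosed G).

Definition quo_rel : rel G := fun x y => x / y \in N.

Fact quo_rel_refl : reflexive quo_rel.
Proof. by move=> x; rewrite /quo_rel divgg gpred1. Qed.

Fact quo_rel_sym : symmetric quo_rel.
Proof. by move=> x y; rewrite /quo_rel gpredFC. Qed.

Fact quo_rel_trans : transitive quo_rel.
Proof.
by move=> y x z xy yz; rewrite /quo_rel -(divgKA y) gpredM.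
Qed.

Canonical quo_equiv := EquivRel quo_rel quo_rel_refl quo_rel_sym quo_rel_trans.

Definition quo := {eq_quot quo_equiv}.
HB.instance Definition _ := Choice.on quo.
HB.instance Definition _ := EqQuotient.on quo.

Definition quo_mul (a b : quo) : quo := \pi_quo (repr a * repr b).
Definition quo_inv (a : quo) : quo := \pi_quo (repr a)^-1.
Definition quo_one : quo := \pi_quo 1.

Lemma quo_eqP (x y : G) : \pi_quo x = \pi_quo y <-> x / y \in N.
Proof. by split=> [/eqmodP|h]; [|apply/eqmodP]. Qed.

Fact quo_repr (x : G) : repr (\pi_quo x) / x \in N.
Proof. by apply/quo_eqP; rewrite reprK. Qed.

Fact quo_piM (x y : G) : quo_mul (\pi_quo x) (\pi_quo y) = \pi_quo (x * y).
Proof.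
apply/quo_eqP; set x' := repr _; set y' := repr _.
have -> : (x' * y') / (x * y) = ((y' / y) ^ x'^-1) * (x' / x).
  by rewrite conjgE invgK invgM !mulgA mulgVK.
by rewrite gpredM ?gpred_conj ?quo_repr.
Qed.

Fact quo_piV (x : G) : quo_inv (\pi_quo x) = \pi_quo x^-1.
Proof.
apply/quo_eqP; set x' := repr _.
have -> : x'^-1 / x^-1 = ((x' / x)^-1) ^ x'.
  by rewrite conjgE invgF invgK mulgVK.
by rewrite gpred_conj // gpredVr // quo_repr.
Qed.

Fact quo_mulA : associative quo_mul.
Proof.
by move=> x; elim/quotW: x => x; move=> y; elim/quotW: y => y; move=> z; elim/quotW: z => z; 
  rewrite (quo_piM y z) (quo_piM x) (quo_piM x y) (quo_piM _ z) mulgA.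
Qed.

Fact quo_mul1g : left_id quo_one quo_mul.
Proof. by move=> x; elim/quotW: x => x; rewrite quo_piM mul1g. Qed.

Fact quo_mulg1 : right_id quo_one quo_mul.
Proof. by move=> x; elim/quotW: x => x; rewrite quo_piM mulg1. Qed.

Fact quo_mulVg : left_inverse quo_one quo_inv quo_mul.
Proof. by move=> x; elim/quotW: x => x; rewrite /quo_one (quo_piV x) (quo_piM _ _) mulVg. Qed.

Fact quo_mulgV : right_inverse quo_one quo_inv quo_mul.
Proof. by move=> x; elim/quotW: x => x; rewrite /quo_one (quo_piV x) (quo_piM _ _) mulgV. Qed.

HB.instance Definition _ := isGroup.Build quo
  quo_mulA quo_mul1g quo_mulg1 quo_mulVg quo_mulgV.

Definition quo_pi (x : G) : quo := \pi_quo x.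

Fact quo_pi_monoid_morphism : monoid_morphism quo_pi.
Proof. by split=> // x y; rewrite /quo_pi -quo_piM. Qed.

HB.instance Definition _ :=
  isUMagmaMorphism.Build G quo quo_pi quo_pi_monoid_morphism.

Section Lift.
Variables (H : groupType) (f : {ghom G -> H}).
Hypothesis fN : forall x, x \in N -> f x = 1.

Definition quo_lift of (forall x, x \in N -> f x = 1) : quo -> H :=
  fun a => f (repr a).

Lemma quo_liftE x : quo_lift fN (quo_pi x) = f x.
Proof. by apply/divg1_eq; rewrite -gmulfF fN ?quo_repr. Qed.

Fact quo_lift_monoid_morphism : monoid_morphism (quo_lift fN).
Proof.
split=> [|a b]; first by rewrite quo_liftE gmulf1.
elim/quotW: a => x; elim/quotW: b => y.
by rewrite -[\pi_quo x]/(quo_pi x) -[\pi_quo y]/(quo_pi y) -gmulfM !quo_liftE gmulfM.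
Qed.

HB.instance Definition _ :=
  isUMagmaMorphism.Build quo H (quo_lift fN) quo_lift_monoid_morphism.
End Lift.

End Quotient.

Arguments quo_lift : simpl never.

Definition kernel (G H : groupType) (f : {ghom G -> H}) : {pred G} :=
  [pred x | f x == 1].

Section Kernel.
Variables (G H : groupType) (f : {ghom G -> H}).

Lemma kernelP x : reflect (f x = 1) (x \in kernel f).
Proof. exact: eqP. Qed.

Fact kernelM : mulg_closed (kernel f).
Proof.
by move=> x y /kernelP fx /kernelP fy; apply/kernelP; rewrite gmulfM fx fy mulg1.
Qed.

Fact kernel1 : 1 \in kernel f.
Proof. by apply/kernelP; rewrite gmulf1. Qed.

Fact kernelV : invg_closed (kernel f).
Proof. by move=> x /kernelP fx; apply/kernelP; rewrite gmulfV fx invg1. Qed.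

HB.instance Definition _ := isMulClosed.Build G (kernel f) kernelM.
HB.instance Definition _ := isMul1Closed.Build G (kernel f) kernel1.
HB.instance Definition _ := isInvClosed.Build G (kernel f) kernelV.
End Kernel.

Section SubgrpMap.
Variables (G H : groupType) (S : groupClosed G) (T : groupClosed H).
Variables (f : {ghom G -> H}) (fST : forall x, x \in S -> f x \in T).

Definition subgrp_map (x : subgrp S) : subgrp T := Subgrp (fST (sgvalP x)).

Fact subgrp_map_monoid_morphism : monoid_morphism subgrp_map.
Proof.
split=> [|x y]; apply: val_inj => /=.
  exact: gmulf1.
exact: gmulfM.
Qed.

HB.instance Definition _ := isUMagmaMorphism.Build
  (subgrp S) (subgrp T) subgrp_map subgrp_map_monoid_morphism.
End SubgrpMap.

Definition generated (G : groupType) (A : {pred G}) : {pred G} :=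
  fun x => `[< forall S : groupClosed G, {subset A <= S} -> x \in S >].

Section Generated.
Variables (G : groupType) (A : {pred G}).

Lemma generatedP x :
  reflect (forall S : groupClosed G, {subset A <= S} -> x \in S)
          (x \in generated A).
Proof. exact: asboolP. Qed.

Fact generatedM : mulg_closed (generated A).
Proof.
move=> x y /generatedP Ax /generatedP Ay; apply/generatedP=> S AS.
by rewrite gpredM ?Ax ?Ay.
Qed.

Fact generated1 : 1 \in generated A.
Proof. by apply/generatedP=> S _; rewrite gpred1. Qed.

Fact generatedV : invg_closed (generated A).
Proof.
by move=> x /generatedP Ax; apply/generatedP=> S AS; rewrite gpredVr ?Ax.
Qed.

HB.instance Definition _ := isMulClosed.Build G (generated A) generatedM.
HB.instance Definition _ := isMul1Closed.Build G (generated A) generated1.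
HB.instance Definition _ := isInvClosed.Build G (generated A) generatedV.

Lemma sub_generated : {subset A <= generated A}.
Proof. by move=> x Ax; apply/generatedP=> S; apply. Qed.
End Generated.

Definition nclosure (G : groupType) (A : {pred G}) : {pred G} :=
  fun x => `[< forall N : normalClosed G, {subset A <= N} -> x \in N >].

Section NormalClosure.
Variables (G : groupType) (A : {pred G}).

Lemma nclosureP x :
  reflect (forall N : normalClosed G, {subset A <= N} -> x \in N)
          (x \in nclosure A).
Proof. exact: asboolP. Qed.

Fact nclosureM : mulg_closed (nclosure A).
Proof.
move=> x y /nclosureP Ax /nclosureP Ay; apply/nclosureP=> N AN.
by rewrite gpredM ?Ax ?Ay.
Qed.

Fact nclosure1 : 1 \in nclosure A.
Proof. by apply/nclosureP=> N _; rewrite gpred1. Qed.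

Fact nclosureV : invg_closed (nclosure A).
Proof.
by move=> x /nclosureP Ax; apply/nclosureP=> N AN; rewrite gpredVr ?Ax.
Qed.

Fact nclosureJ x y : x \in nclosure A -> x ^ y \in nclosure A.
Proof.
by move=> /nclosureP Ax; apply/nclosureP=> N AN; rewrite gpred_conj ?Ax.
Qed.

HB.instance Definition _ := isMulClosed.Build G (nclosure A) nclosureM.
HB.instance Definition _ := isMul1Closed.Build G (nclosure A) nclosure1.
HB.instance Definition _ := isInvClosed.Build G (nclosure A) nclosureV.
HB.instance Definition _ := isConjClosed.Build G (nclosure A) nclosureJ.
End NormalClosure.

Definition nprod (G : groupType) (M N : normalClosed G) : {pred G} :=
  fun x => `[< exists m n, [/\ m \in M, n \in N & x = m * n] >].

Section NormalProduct.
Variables (G : groupType) (M N : normalClosed G).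

Lemma nprodP x :
  reflect (exists m n, [/\ m \in M, n \in N & x = m * n]) (x \in nprod M N).
Proof. exact: asboolP. Qed.

Fact nprodM : mulg_closed (nprod M N).
Proof.
move=> _ _ /nprodP[m [n [Mm Nn ->]]] /nprodP[m' [n' [Mm' Nn' ->]]].
apply/nprodP; exists (m * m'), (n ^ m' * n').
split; first exact: gpredM.
  by apply: gpredM => //; apply: gpred_conj.
by rewrite conjgE !mulgA mulgK.
Qed.

Fact nprod1 : 1 \in nprod M N.
Proof. by apply/nprodP; exists 1, 1; split; rewrite ?gpred1 ?mulg1. Qed.

Fact nprodV : invg_closed (nprod M N).
Proof.
move=> _ /nprodP[m [n [Mm Nn ->]]]; apply/nprodP.
exists m^-1, (n^-1 ^ m^-1).
split; first exact: gpredVr.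
  exact/gpred_conj/gpredVr.
by rewrite conjgE invgK invgM !mulgA mulVg mul1g.
Qed.

Fact nprodJ x y : x \in nprod M N -> x ^ y \in nprod M N.
Proof.
move=> /nprodP[m [n [Mm Nn ->]]]; apply/nprodP; exists (m ^ y), (n ^ y).
by split; rewrite ?conjMg ?gpred_conj.
Qed.

HB.instance Definition _ := isMulClosed.Build G (nprod M N) nprodM.
HB.instance Definition _ := isMul1Closed.Build G (nprod M N) nprod1.
HB.instance Definition _ := isInvClosed.Build G (nprod M N) nprodV.
HB.instance Definition _ := isConjClosed.Build G (nprod M N) nprodJ.

Lemma sub_nprodl : {subset M <= nprod M N}.
Proof. by move=> x Mx; apply/nprodP; exists x, 1; split; rewrite ?gpred1 ?mulg1. Qed.

Lemma sub_nprodr : {subset N <= nprod M N}.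
Proof. by move=> x Nx; apply/nprodP; exists 1, x; split; rewrite ?gpred1 ?mul1g. Qed.
End NormalProduct.

Section QuotientProjection.
Variables (G : groupType) (N N' : normalClosed G).

Fact quo_proj_subproof (NN' : {subset N <= N'}) x :
  x \in N -> quo_pi N' x = 1.
Proof. by move=> Nx; apply/quo_eqP; rewrite divg1 NN'. Qed.

Definition quo_proj (NN' : {subset N <= N'}) : quo N -> quo N' :=
  quo_lift (quo_proj_subproof NN').
HB.instance Definition _ (NN' : {subset N <= N'}) :=
  UMagmaMorphism.on (quo_proj NN').

Lemma quo_projE (NN' : {subset N <= N'}) x :
  quo_proj NN' (quo_pi N x) = quo_pi N' x.
Proof. exact: quo_liftE. Qed.
End QuotientProjection.

Definition derived (G : groupType) : {pred G} :=
  generated (fun z => `[< exists x y, z = [~ x, y] >]).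

Arguments derived : clear implicits.

Section Abelianization.
Variable G : groupType.

HB.instance Definition _ := GroupClosed.on (derived G).

Fact derived_commg (x y : G) : [~ x, y] \in derived G.
Proof. by apply: sub_generated; apply/asboolP; exists x, y. Qed.

Fact derivedJ (x y : G) : x \in derived G -> x ^ y \in derived G.
Proof.
by move=> Gx; rewrite -[x ^ y](mulVKg x) gpredM // -commgEl derived_commg.
Qed.

HB.instance Definition _ := isConjClosed.Build G (derived G) derivedJ.
End Abelianization.

Definition ab (G : groupType) : groupType := quo (derived G).

Section AbelianizationMap.
Variables (G H : groupType) (f : {ghom G -> H}).

Fact ab_map_subproof x :
  x \in derived G -> (quo_pi (derived H) \o f) x = 1.
Proof.
move=> /generatedP Gx; apply/eqP.
apply: (Gx (kernel (quo_pi (derived H) \o f))) => _ /asboolP[y [z ->]].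
apply/kernelP/quo_eqP; rewrite divg1 gmulfR.
exact: derived_commg.
Qed.

Definition ab_map : ab G -> ab H := quo_lift ab_map_subproof.
HB.instance Definition _ := UMagmaMorphism.on ab_map.

Lemma ab_mapE x : ab_map (quo_pi _ x) = quo_pi _ (f x).
Proof. exact: quo_liftE. Qed.
End AbelianizationMap.
Arguments ab_map : simpl never.

(* Words in the disjoint union of G and H, modulo the congruence generated by
   multiplying adjacent letters of the same group and erasing units. *)
Inductive fp_step (G H : groupType) : seq (G + H) -> seq (G + H) -> Prop :=
| fp_mull u v x y : fp_step (u ++ [:: inl x; inl y] ++ v) (u ++ inl (x * y) :: v)
| fp_mulr u v x y : fp_step (u ++ [:: inr x; inr y] ++ v) (u ++ inr (x * y) :: v)
| fp_onel u v : fp_step (u ++ inl 1 :: v) (u ++ v)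
| fp_oner u v : fp_step (u ++ inr 1 :: v) (u ++ v).

Section FreeProduct.
Variables G H : groupType.
Implicit Types u v w : seq (G + H).

Definition fp_eq : seq (G + H) -> seq (G + H) -> Prop :=
  clos_refl_sym_trans _ (@fp_step G H).

Definition fp_rel : rel (seq (G + H)) := fun u v => `[< fp_eq u v >].

Fact fp_rel_refl : reflexive fp_rel.
Proof. by move=> u; apply/asboolP/rst_refl. Qed.

Fact fp_rel_sym : symmetric fp_rel.
Proof. by move=> u v; apply/asboolP/asboolP; apply: rst_sym. Qed.

Fact fp_rel_trans : transitive fp_rel.
Proof.
by move=> v u w /asboolP uv /asboolP vw; apply/asboolP/(rst_trans _ _ _ _ _ uv).
Qed.

Canonical fp_equiv := EquivRel fp_rel fp_rel_refl fp_rel_sym fp_rel_trans.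

Definition freeprod := {eq_quot fp_equiv}.
HB.instance Definition _ := Choice.on freeprod.
HB.instance Definition _ := EqQuotient.on freeprod.

Lemma freeprod_eqP u v : \pi_freeprod u = \pi_freeprod v <-> fp_eq u v.
Proof. by split=> [/eqmodP/asboolP|uv]; [|apply/eqmodP/asboolP]. Qed.

Fact fp_eq_repr u : fp_eq (repr (\pi_freeprod u)) u.
Proof. by apply/freeprod_eqP; rewrite reprK. Qed.

Fact fp_eq_cat u u' v v' : fp_eq u u' -> fp_eq v v' -> fp_eq (u ++ v) (u' ++ v').
Proof.
move=> uu' vv'; apply: (@rst_trans _ _ _ (u' ++ v)).
  elim: uu' {vv'} => {u u'} [u u' uu'|u|u u' _ IH|u u' u'' _ IH _ IH'].
  - by apply: rst_step; case: uu' => *; rewrite -!catA; constructor.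
  - exact: rst_refl.
  - exact: rst_sym.
  - exact: rst_trans IH IH'.
elim: vv' => {v v'} [v v' vv'|v|v v' _ IH|v v' v'' _ IH _ IH'].
- by apply: rst_step; case: vv' => *; rewrite !(catA u'); constructor.
- exact: rst_refl.
- exact: rst_sym.
- exact: rst_trans IH IH'.
Qed.

Definition fp_letter_inv (a : G + H) : G + H :=
  match a with inl x => inl x^-1 | inr y => inr y^-1 end.

Definition fp_inv u := rev (map fp_letter_inv u).

Fact fp_invK : involutive fp_inv.
Proof.
move=> u; rewrite /fp_inv map_rev revK mapK // => -[] x /=.
  by rewrite invgK.
by rewrite invgK.
Qed.

Fact fp_inv_cat u v : fp_inv (u ++ v) = fp_inv v ++ fp_inv u.
Proof. by rewrite /fp_inv map_cat rev_cat. Qed.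

Fact fp_inv_eq u v : fp_eq u v -> fp_eq (fp_inv u) (fp_inv v).
Proof.
elim=> {u v} [u v uv|u|u v _ IH|u v w _ IH _ IH'].
- apply: rst_step.
  case: uv => u' v' => [x y|x y||];
    rewrite !fp_inv_cat /fp_inv /= !rev_cons -!cats1 -!catA /= ?invgM ?invg1;
    by constructor.
- exact: rst_refl.
- exact: rst_sym.
- exact: rst_trans IH IH'.
Qed.

Fact fp_catV u : fp_eq (u ++ fp_inv u) [::].
Proof.
elim: u => [|a u IH]; first exact: rst_refl.
have -> : (a :: u) ++ fp_inv (a :: u) =
    ([:: a] ++ (u ++ fp_inv u)) ++ [:: fp_letter_inv a].
  by rewrite /fp_inv /= rev_cons -cats1 -!catA.
apply: (@rst_trans _ _ _ [:: a; fp_letter_inv a]).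
  apply: (@fp_eq_cat _ [:: a]); last exact: rst_refl.
  by rewrite -[X in fp_eq _ X]cats0; apply: fp_eq_cat => //; exact: rst_refl.
case: a => x /=; [apply: (@rst_trans _ _ _ [:: inl 1])
                 |apply: (@rst_trans _ _ _ [:: inr 1])].
- by rewrite -(mulgV x); apply: rst_step; apply: (@fp_mull _ _ [::] [::]).
- by apply: rst_step; apply: (@fp_onel _ _ [::] [::]).
- by rewrite -(mulgV x); apply: rst_step; apply: (@fp_mulr _ _ [::] [::]).
- by apply: rst_step; apply: (@fp_oner _ _ [::] [::]).
Qed.

Definition freeprod_mul (a b : freeprod) : freeprod := \pi_freeprod (repr a ++ repr b).
Definition freeprod_inv (a : freeprod) : freeprod := \pi_freeprod (fp_inv (repr a)).
Definition freeprod_one : freeprod := \pi_freeprod [::].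

Fact freeprod_piM u v :
  freeprod_mul (\pi_freeprod u) (\pi_freeprod v) = \pi_freeprod (u ++ v).
Proof. by apply/freeprod_eqP/fp_eq_cat; apply: fp_eq_repr. Qed.

Fact freeprod_piV u : freeprod_inv (\pi_freeprod u) = \pi_freeprod (fp_inv u).
Proof. exact/freeprod_eqP/fp_inv_eq/fp_eq_repr. Qed.

Fact freeprod_mulA : associative freeprod_mul.
Proof.
by move=> u; elim/quotW: u => u; move=> v; elim/quotW: v => v; move=> w; elim/quotW: w => w; 
  rewrite (freeprod_piM v w) (freeprod_piM u) (freeprod_piM u v) (freeprod_piM _ w) catA.
Qed.

Fact freeprod_mul1g : left_id freeprod_one freeprod_mul.
Proof. by move=> u; elim/quotW: u => u; rewrite freeprod_piM. Qed.

Fact freeprod_mulg1 : right_id freeprod_one freeprod_mul.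
Proof. by move=> u; elim/quotW: u => u; rewrite freeprod_piM cats0. Qed.

Fact freeprod_mulVg : left_inverse freeprod_one freeprod_inv freeprod_mul.
Proof.
move=> u; elim/quotW: u => u; rewrite /freeprod_one (freeprod_piV u) (freeprod_piM _ _); apply/freeprod_eqP.
by rewrite -{2}(fp_invK u); apply: fp_catV.
Qed.

Fact freeprod_mulgV : right_inverse freeprod_one freeprod_inv freeprod_mul.
Proof.
by move=> u; elim/quotW: u => u; rewrite /freeprod_one (freeprod_piV u) (freeprod_piM _ _); apply/freeprod_eqP/fp_catV.
Qed.

HB.instance Definition _ := isGroup.Build freeprod
  freeprod_mulA freeprod_mul1g freeprod_mulg1 freeprod_mulVg freeprod_mulgV.

Lemma freeprod_mulE u v : \pi_freeprod (u ++ v) = \pi_freeprod u * \pi_freeprod v.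
Proof. by rewrite -freeprod_piM. Qed.

Definition fp_inl (x : G) : freeprod := \pi_freeprod [:: inl x].
Definition fp_inr (y : H) : freeprod := \pi_freeprod [:: inr y].

Fact fp_inl_monoid_morphism : monoid_morphism fp_inl.
Proof.
split=> [|x y]; rewrite /fp_inl -?freeprod_mulE; apply/freeprod_eqP.
  by apply: rst_step; apply: (@fp_onel _ _ [::] [::]).
by apply/rst_sym/rst_step; apply: (@fp_mull _ _ [::] [::]).
Qed.

Fact fp_inr_monoid_morphism : monoid_morphism fp_inr.
Proof.
split=> [|x y]; rewrite /fp_inr -?freeprod_mulE; apply/freeprod_eqP.
  by apply: rst_step; apply: (@fp_oner _ _ [::] [::]).
by apply/rst_sym/rst_step; apply: (@fp_mulr _ _ [::] [::]).
Qed.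

HB.instance Definition _ :=
  isUMagmaMorphism.Build G freeprod fp_inl fp_inl_monoid_morphism.
HB.instance Definition _ :=
  isUMagmaMorphism.Build H freeprod fp_inr fp_inr_monoid_morphism.

Section Elim.
Variables (K : groupType) (f : {ghom G -> K}) (g : {ghom H -> K}).

Definition fp_letter (a : G + H) : K :=
  match a with inl x => f x | inr y => g y end.

Definition fp_eval u : K := \prod_(a <- u) fp_letter a.

Definition fp_elim (a : freeprod) : K := fp_eval (repr a).

Fact fp_evalE u v : fp_eq u v -> fp_eval u = fp_eval v.
Proof.
elim=> {u v} [u v uv|//|u v _ ->//|u v w _ -> _ -> //].
by case: uv => u' v' => [x y|x y||]; rewrite /fp_eval !big_cat ?big_cons /=
  ?big_nil ?gmulfM ?gmulf1 ?mul1g ?mulg1 ?mulgA.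
Qed.

Fact fp_elim_pi u : fp_elim (\pi_freeprod u) = fp_eval u.
Proof. exact/fp_evalE/fp_eq_repr. Qed.

Fact fp_elim_monoid_morphism : monoid_morphism fp_elim.
Proof.
split=> [|a b]; first by rewrite fp_elim_pi /fp_eval big_nil.
elim/quotW: a => u; elim/quotW: b => v.
by rewrite -freeprod_mulE !fp_elim_pi /fp_eval big_cat.
Qed.

HB.instance Definition _ :=
  isUMagmaMorphism.Build freeprod K fp_elim fp_elim_monoid_morphism.

Lemma fp_elim_inl x : fp_elim (fp_inl x) = f x.
Proof. by rewrite fp_elim_pi /fp_eval big_seq1. Qed.

Lemma fp_elim_inr y : fp_elim (fp_inr y) = g y.
Proof. by rewrite fp_elim_pi /fp_eval big_seq1. Qed.

Lemma fp_elim_uniq (h : {ghom freeprod -> K}) :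
  (forall x, h (fp_inl x) = f x) -> (forall y, h (fp_inr y) = g y) ->
  h =1 fp_elim.
Proof.
move=> hf hg; move=> u; elim/quotW: u => u; rewrite fp_elim_pi /fp_eval.
elim: u => [|a u IH]; first by rewrite big_nil gmulf1.
rewrite -cat1s freeprod_mulE gmulfM IH big_cat big_seq1 /=; congr (_ * _).
by case: a => x /=; rewrite -?hf -?hg.
Qed.
End Elim.

End FreeProduct.

(* The normal closure of M * N in G * H, where the free product M * N is
   mapped to G * H by the morphism extending the two inclusions. *)
Section NormalClosureFreeProduct.
Variables (G H : groupType) (M : normalClosed G) (N : normalClosed H).

Definition freeprod_incl : {ghom freeprod (subgrp M) (subgrp N) -> freeprod G H} :=
  fp_elim (@fp_inl G H \o (val : subgrp M -> G))
          (@fp_inr G H \o (val : subgrp N -> H)).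

Definition freeprod_ncl : {pred freeprod G H} :=
  nclosure (fun x => `[< exists w, x = freeprod_incl w >]).

HB.instance Definition _ := NormalClosed.on freeprod_ncl.
End NormalClosureFreeProduct.

(* [inord k] is the index k; the hypotheses on i and j keep all indices in
   range. *)
Record sgroup := SGroup {
  sgrp :> nat -> groupType;
  face : forall n, 'I_n.+2 -> {ghom sgrp n.+1 -> sgrp n};
  degen : forall n, 'I_n.+1 -> {ghom sgrp n -> sgrp n.+1};
  face_face : forall n (i j : nat) (x : sgrp n.+2), i < j <= n.+2 ->
    face (inord i) (face (inord j) x) = face (inord j.-1) (face (inord i) x);
  degen_degen : forall n (i j : nat) (x : sgrp n), i <= j <= n ->
    degen (inord i) (degen (inord j) x) = degen (inord j.+1) (degen (inord i) x);
  face_degen_lt : forall n (i j : nat) (x : sgrp n.+1), i < j <= n.+1 ->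
    face (inord i) (degen (inord j) x) = degen (inord j.-1) (face (inord i) x);
  face_degen_id : forall n (i j : nat) (x : sgrp n), j <= n ->
    i = j \/ i = j.+1 -> face (inord i) (degen (inord j) x) = x;
  face_degen_gt : forall n (i j : nat) (x : sgrp n.+1), j.+1 < i <= n.+2 ->
    face (inord i) (degen (inord j) x) = degen (inord j) (face (inord i.-1) x)
}.

Arguments face {s n} _.
Arguments degen {s n} _.

Record smor (K L : sgroup) := SMor {
  smap :> forall n, {ghom K n -> L n};
  smap_face : forall n (i : 'I_n.+2) x, smap n (face i x) = face i (smap n.+1 x);
  smap_degen : forall n (i : 'I_n.+1) x, smap n.+1 (degen i x) = degen i (smap n x)
}.

Definition ssurjective (K L : sgroup) (f : smor K L) : Prop :=
  forall n, surjective (f n).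

Definition scommutes (A B C D : sgroup) (f : smor A B) (g : smor C D)
    (u : smor A C) (v : smor B D) : Prop :=
  forall n x, g n (u n x) = v n (f n x).

Lemma scommutes_sym (A B C D : sgroup) (f : smor A B) (g : smor C D)
    (u : smor A C) (v : smor B D) :
  scommutes f g u v -> scommutes u v f g.
Proof. by move=> fguv n x. Qed.

Section SimplicialAb.
Variable K : sgroup.

Lemma ab_elim (G : groupType) (P : ab G -> Prop) :
  (forall x, P (quo_pi _ x)) -> forall a, P a.
Proof. by move=> IH; elim/quotW. Qed.

Definition sab : sgroup.
Proof.
apply: (@SGroup (fun n => ab (K n)) (fun n i => ab_map (face i))
                (fun n i => ab_map (degen i))).
- by move=> n i j x ij; elim/ab_elim: x => x; rewrite /= !ab_mapE face_face.
- by move=> n i j x ij; elim/ab_elim: x => x; rewrite /= !ab_mapE degen_degen.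
- by move=> n i j x ij; elim/ab_elim: x => x; rewrite /= !ab_mapE face_degen_lt.
- by move=> n i j x jn ij; elim/ab_elim: x => x; 
  rewrite /= (ab_mapE (degen _) x) ab_mapE face_degen_id.
- by move=> n i j x ij; elim/ab_elim: x => x; rewrite /= !ab_mapE face_degen_gt.
Defined.
End SimplicialAb.

Definition sab_map (K L : sgroup) (f : smor K L) : smor (sab K) (sab L).
Proof.
apply: (@SMor (sab K) (sab L) (fun n => ab_map (f n))).
- by move=> n i x; elim/ab_elim: x => x; rewrite /= !ab_mapE smap_face.
- by move=> n i x; elim/ab_elim: x => x; rewrite /= !ab_mapE smap_degen.
Defined.

Lemma sab_commutes (A B C D : sgroup) (f : smor A B) (g : smor C D)
    (u : smor A C) (v : smor B D) :
  scommutes f g u v ->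
  scommutes (sab_map f) (sab_map g) (sab_map u) (sab_map v).
Proof. by move=> fguv n x; elim/ab_elim: x => x; rewrite /= !ab_mapE fguv. Qed.

Section SimplicialKernel.
Variables (K L : sgroup) (f : smor K L).

Fact sker_face n (i : 'I_n.+2) x : x \in kernel (f n.+1) -> face i x \in kernel (f n).
Proof. by move=> /kernelP fx; apply/kernelP; rewrite smap_face fx gmulf1. Qed.

Fact sker_degen n (i : 'I_n.+1) x : x \in kernel (f n) -> degen i x \in kernel (f n.+1).
Proof. by move=> /kernelP fx; apply/kernelP; rewrite smap_degen fx gmulf1. Qed.

Definition sker : sgroup.
Proof.
apply: (@SGroup (fun n => subgrp (kernel (f n)))
  (fun n i => subgrp_map (@sker_face n i))
  (fun n i => subgrp_map (@sker_degen n i))).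
- by move=> n i j x ij; apply: val_inj; rewrite /= face_face.
- by move=> n i j x ij; apply: val_inj; rewrite /= degen_degen.
- by move=> n i j x ij; apply: val_inj; rewrite /= face_degen_lt.
- by move=> n i j x jn ij; apply: val_inj; rewrite /= face_degen_id.
- by move=> n i j x ij; apply: val_inj; rewrite /= face_degen_gt.
Defined.
End SimplicialKernel.

(* The morphism ker f -> ker g induced by u in the commutative square
   g u = v f. *)
Section SimplicialKernelMap.
Variables (A B C D : sgroup) (f : smor A B) (g : smor C D).
Variables (u : smor A C) (v : smor B D).

Fact sker_map_subproof (fguv : scommutes f g u v) n x :
  x \in kernel (f n) -> u n x \in kernel (g n).
Proof. by move=> /kernelP fx; apply/kernelP; rewrite fguv fx gmulf1. Qed.

Definition sker_map (fguv : scommutes f g u v) : smor (sker f) (sker g).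
Proof.
apply: (@SMor (sker f) (sker g)
  (fun n => subgrp_map (@sker_map_subproof fguv n))).
- by move=> n i x; apply: val_inj; rewrite /= smap_face.
- by move=> n i x; apply: val_inj; rewrite /= smap_degen.
Defined.
End SimplicialKernelMap.

(* The homotopy groups of a simplicial group, as the homology groups of its
   Moore complex: n-cycles have all faces trivial, and boundaries are the
   zeroth faces of elements all of whose other faces are trivial. *)
Definition scycles (K : sgroup) (n : nat) : {pred K n} :=
  match n with
  | 0 => predT
  | m.+1 => [pred x | [forall i, face i x == 1]]
  end.

Arguments scycles : clear implicits.

Section Cycles.
Variables (K : sgroup) (n : nat).

Lemma scyclesSP m (x : K m.+1) :
  reflect (forall i, face i x = 1) (x \in scycles K m.+1).
Proof. exact: 'forall_eqP. Qed.

Fact scyclesM : mulg_closed (scycles K n).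
Proof.
case: n => [|m] x y // /scyclesSP dx /scyclesSP dy; apply/scyclesSP=> i.
by rewrite gmulfM dx dy mulg1.
Qed.

Fact scycles1 : 1 \in scycles K n.
Proof. by case: n => [|m] //; apply/scyclesSP=> i; rewrite gmulf1. Qed.

Fact scyclesV : invg_closed (scycles K n).
Proof.
case: n => [|m] x // /scyclesSP dx; apply/scyclesSP=> i.
by rewrite gmulfV dx invg1.
Qed.

HB.instance Definition _ := isMulClosed.Build (K n) (scycles K n) scyclesM.
HB.instance Definition _ := isMul1Closed.Build (K n) (scycles K n) scycles1.
HB.instance Definition _ := isInvClosed.Build (K n) (scycles K n) scyclesV.
End Cycles.

Definition sboundaries (K : sgroup) (n : nat) : {pred subgrp (scycles K n)} :=
  fun x => `[< exists2 y : K n.+1,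
                 forall i : 'I_n.+2, i != ord0 -> face i y = 1
               & sgval x = face ord0 y >].

Arguments sboundaries : clear implicits.

Section Boundaries.
Variables (K : sgroup) (n : nat).

Lemma sboundariesP x :
  reflect (exists2 y : K n.+1,
             forall i : 'I_n.+2, i != ord0 -> face i y = 1
           & sgval x = face ord0 y)
          (x \in sboundaries K n).
Proof. exact: asboolP. Qed.

Fact sboundariesM : mulg_closed (sboundaries K n).
Proof.
move=> a b /sboundariesP[x dx ax] /sboundariesP[y dy bY].
apply/sboundariesP; exists (x * y) => [i i0|].
  by rewrite gmulfM dx // dy // mulg1.
by rewrite sgvalM ax bY -gmulfM.
Qed.

Fact sboundaries1 : 1 \in sboundaries K n.
Proof.
by apply/sboundariesP; exists 1 => [i _|]; rewrite ?sgval1 gmulf1.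
Qed.

Fact sboundariesV : invg_closed (sboundaries K n).
Proof.
move=> a /sboundariesP[x dx ax].
apply/sboundariesP; exists x^-1 => [i i0|].
  by rewrite gmulfV dx // invg1.
by rewrite sgvalV ax -gmulfV.
Qed.

Fact sboundariesJ a b : a \in sboundaries K n -> a ^ b \in sboundaries K n.
Proof.
move=> /sboundariesP[x dx ax].
apply/sboundariesP; exists (x ^ degen (inord 0) (sgval b)) => [i i0|].
  by rewrite gmulfJ dx // conj1g.
rewrite gmulfJ -ax.
have -> : ord0 = inord 0 :> 'I_n.+2 by apply: val_inj; rewrite /= inordK.
rewrite face_degen_id //; last by left.
Qed.

HB.instance Definition _ :=
  isMulClosed.Build (subgrp (scycles K n)) (sboundaries K n) sboundariesM.
HB.instance Definition _ :=
  isMul1Closed.Build (subgrp (scycles K n)) (sboundaries K n) sboundaries1.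
HB.instance Definition _ :=
  isInvClosed.Build (subgrp (scycles K n)) (sboundaries K n) sboundariesV.
HB.instance Definition _ :=
  isConjClosed.Build (subgrp (scycles K n)) (sboundaries K n) sboundariesJ.
End Boundaries.

Definition hgroup (n : nat) (K : sgroup) : groupType := quo (sboundaries K n).

Section HomotopyMap.
Variables (n : nat) (K L : sgroup) (f : smor K L).

Fact scycles_map x : x \in scycles K n -> f n x \in scycles L n.
Proof.
case: n x => [|m] x // /scyclesSP dx; apply/scyclesSP=> i.
by rewrite -smap_face dx gmulf1.
Qed.

Fact hgroup_map_subproof x : x \in sboundaries K n ->
  (quo_pi (sboundaries L n) \o subgrp_map scycles_map) x = 1.
Proof.
move=> /sboundariesP[y dy xy]; apply/quo_eqP; rewrite divg1.
apply/sboundariesP; exists (f n.+1 y) => [i i0|].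
  by rewrite -smap_face dy // gmulf1.
by rewrite -smap_face -xy.
Qed.

Definition hgroup_map : hgroup n K -> hgroup n L :=
  quo_lift hgroup_map_subproof.
HB.instance Definition _ := UMagmaMorphism.on hgroup_map.

Lemma hgroup_mapE x :
  hgroup_map (quo_pi _ x) = quo_pi _ (subgrp_map scycles_map x).
Proof. exact: quo_liftE. Qed.
End HomotopyMap.

Arguments hgroup_map n {K L} f.

Definition free_basis (F : groupType) (B : {pred F}) : Prop :=
  forall (H : groupType) (h : F -> H),
    exists2 f : {ghom F -> H}, {in B, f =1 h}
      & forall f' : {ghom F -> H}, {in B, f' =1 h} -> f' =1 f.

Definition free_sgroup (K : sgroup) : Prop :=
  exists B : forall n, {pred K n},
    (forall n, free_basis (B n)) /\
    (forall n (i : 'I_n.+1) x, x \in B n -> degen i x \in B n.+1).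

(* The identification of pi_0 with G is part of the data. *)
Record resolution (G : groupType) := Resolution {
  res :> sgroup;
  res_free : free_sgroup res;
  res_iso : {ghom hgroup 0 res -> G};
  res_isoP : bijective res_iso;
  res_acyclic : forall n, 0 < n -> forall a : hgroup n res, a = 1
}.

Arguments res_iso {G} _.

(* K -> L is alpha, K -> R is beta, R -> S is gamma and L -> S is delta. *)
Record res_square (G : groupType) (M N : normalClosed G) := ResSquare {
  rsK : resolution G;
  rsL : resolution (quo N);
  rsR : resolution (quo M);
  rsS : resolution (quo (nprod M N));
  rs_alpha : smor rsK rsL;
  rs_beta : smor rsK rsR;
  rs_gamma : smor rsR rsS;
  rs_delta : smor rsL rsS;
  rs_comm : scommutes rs_alpha rs_gamma rs_beta rs_delta;
  rs_alpha_pi0 : forall a,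
    res_iso rsL (hgroup_map 0 rs_alpha a) = quo_pi N (res_iso rsK a);
  rs_beta_pi0 : forall a,
    res_iso rsR (hgroup_map 0 rs_beta a) = quo_pi M (res_iso rsK a);
  rs_gamma_pi0 : forall a,
    res_iso rsS (hgroup_map 0 rs_gamma a) =
    quo_proj (@sub_nprodl G M N) (res_iso rsR a);
  rs_delta_pi0 : forall a,
    res_iso rsS (hgroup_map 0 rs_delta a) =
    quo_proj (@sub_nprodr G M N) (res_iso rsL a);
  rs_alpha_surj : ssurjective (sab_map rs_alpha);
  rs_beta_surj : ssurjective (sab_map rs_beta);
  rs_gamma_surj : ssurjective (sab_map rs_gamma);
  rs_delta_surj : ssurjective (sab_map rs_delta);
  rs_ker_alpha_surj : ssurjective (sker_map (sab_commutes rs_comm));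
  rs_ker_beta_surj : ssurjective (sker_map (sab_commutes (scommutes_sym rs_comm)))
}.

Arguments rs_comm {G M N} _ [n] x.

(* M(G, M, N); the square of resolutions from which it is computed is an
   argument because M(G, M, N) is determined only up to isomorphism. *)
Definition schur_multiplier (G : groupType) (M N : normalClosed G)
    (X : res_square M N) : groupType :=
  hgroup 1 (sker (sker_map (sab_commutes (rs_comm X)))).

(* Main.v *)
Require Import Defs.
From HB Require Import structures.
From mathcomp Require Import all_boot ssralg boolp.

(* For a free group K, with free group functor F on sets and counit
   eps : F K -> K, a section of eps turns the cotriple resolution F^{p+1} K
   into a contractible one; so abelianizing F^p K_q for a free simplicial
   resolution K of G gives a double complex that is exact in the direction p.
   The terms with p >= 1 only depend on the underlying sets, on which the
   augmented K -> G is contractible because K is acyclic; so it is exact in the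
   direction q as well, up to the augmentation row made of the ab (F^p G),
   p >= 1. All of this is natural in K -> G. Taking moreover the total complex
   over a square of resolutions, H_1 of the total kernel of the abelianized
   square is identified with the homology of a complex that depends only on the
   square formed by G, G/N, G/M and G/MN.
   The degreewise free products of two such squares K1 and K2 again have
   sections of eps and set-level contractions, their total kernel is the
   product of those of K1 and K2, and they augment to the square of G1 * G2,
   because (G1 * G2)/<N1 * N2> = G1/N1 * G2/N2 and similarly for the other
   corners. *)

Set Implicit Arguments.
Unset Strict Implicit.
Unset Printing Implicit Defensive.

Import GRing.Theory.
Local Open Scope quotient_scope.
Local Open Scope group_scope.

(** * Free groups and their iterates *)

(** The square [X] is arbitrary, so beyond the groups at the four corners nothing relates it to [X1]
    and [X2]: the comparison has to pass through the augmentation row. It is carried by a relation,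
    being homologous in the total complex, rather than by a map, so that no choice of bounding chain
    has to be made additive. An additive relation that is total on both sides and respects
    boundaries in both directions already yields an isomorphism. The entry p = q = 0 is out of reach
    of both contractions, since one needs p >= 1 and the other q >= 1. Chains are therefore compared
    away from it. This is consistent because the differential at an entry only involves entries with
    p and q at least as large, and because the boundary of a cycle of degree 1 lies at p = 0, q =
    1. *)

Definition feval (S : Type) (G : groupType) (f : S -> G)
    (u : seq (bool * S)) : G :=
  \prod_(a <- u) if a.1 then f a.2 else (f a.2)^-1.

Section FreeGroup.
Variable S : choiceType.
Implicit Types u v : seq (bool * S).

(* Two words are equal in the free group on [S] as soon as they have the same
   value in every group; this makes all the group laws immediate. *)
Definition fg_rel : rel (seq (bool * S)) := fun u v =>
  `[< forall (G : groupType) (f : S -> G), feval f u = feval f v >].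

Fact fg_rel_refl : reflexive fg_rel.
Proof. by move=> u; apply/asboolP. Qed.

Fact fg_rel_sym : symmetric fg_rel.
Proof. by move=> u v; apply/asboolP/asboolP=> uv G f; rewrite uv. Qed.

Fact fg_rel_trans : transitive fg_rel.
Proof.
by move=> v u w /asboolP uv /asboolP vw; apply/asboolP=> G f; rewrite uv.
Qed.

Canonical fg_equiv := EquivRel fg_rel fg_rel_refl fg_rel_sym fg_rel_trans.

Definition fgroup := {eq_quot fg_equiv}.
HB.instance Definition _ := Choice.on fgroup.
HB.instance Definition _ := EqQuotient.on fgroup.

Lemma fgroup_eqP u v : \pi_fgroup u = \pi_fgroup v <->
  forall (G : groupType) (f : S -> G), feval f u = feval f v.
Proof. by split=> [/eqmodP/asboolP|uv]; [|apply/eqmodP/asboolP]. Qed.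

Lemma feval_repr (G : groupType) (f : S -> G) u :
  feval f (repr (\pi_fgroup u)) = feval f u.
Proof. by apply: (fgroup_eqP _ _).1; rewrite reprK. Qed.

Definition fg_mul (a b : fgroup) : fgroup := \pi_fgroup (repr a ++ repr b).
Definition fg_inv (a : fgroup) : fgroup :=
  \pi_fgroup (rev (map (fun c => (~~ c.1, c.2)) (repr a))).
Definition fg_one : fgroup := \pi_fgroup [::].

Definition flift (G : groupType) (f : S -> G) (a : fgroup) : G := feval f (repr a).

Fact fgroup_inj (a b : fgroup) :
  (forall (G : groupType) (f : S -> G), flift f a = flift f b) -> a = b.
Proof. by move=> ab; rewrite -[a]reprK -[b]reprK; apply/fgroup_eqP. Qed.

Fact flift_mul (G : groupType) (f : S -> G) (a b : fgroup) :
  flift f (fg_mul a b) = flift f a * flift f b.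
Proof. by rewrite /flift feval_repr /feval big_cat. Qed.

Fact flift_one (G : groupType) (f : S -> G) : flift f fg_one = 1.
Proof. by rewrite /flift feval_repr /feval big_nil. Qed.

Fact flift_inv (G : groupType) (f : S -> G) (a : fgroup) :
  flift f (fg_inv a) = (flift f a)^-1.
Proof.
rewrite /flift feval_repr; elim: (repr a) => [|[b s] u IH].
  by rewrite /feval big_nil invg1.
rewrite /= rev_cons -cats1 /feval big_cat big_seq1 big_cons invgM /=.
by rewrite -[X in X * _]/(feval f _) IH; case: b; rewrite /= ?invgK.
Qed.

Fact fg_mulA : associative fg_mul.
Proof. by move=> a b c; apply: fgroup_inj => G f; rewrite !flift_mul mulgA. Qed.

Fact fg_mul1g : left_id fg_one fg_mul.
Proof. by move=> a; apply: fgroup_inj => G f; rewrite flift_mul flift_one mul1g. Qed.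

Fact fg_mulg1 : right_id fg_one fg_mul.
Proof. by move=> a; apply: fgroup_inj => G f; rewrite flift_mul flift_one mulg1. Qed.

Fact fg_mulVg : left_inverse fg_one fg_inv fg_mul.
Proof.
by move=> a; apply: fgroup_inj => G f; rewrite flift_mul flift_inv flift_one mulVg.
Qed.

Fact fg_mulgV : right_inverse fg_one fg_inv fg_mul.
Proof.
by move=> a; apply: fgroup_inj => G f; rewrite flift_mul flift_inv flift_one mulgV.
Qed.

HB.instance Definition _ := isGroup.Build fgroup
  fg_mulA fg_mul1g fg_mulg1 fg_mulVg fg_mulgV.

Fact flift_monoid_morphism (G : groupType) (f : S -> G) :
  monoid.monoid_morphism (flift f).
Proof. by split=> [|a b]; [exact: flift_one|exact: flift_mul]. Qed.

HB.instance Definition _ (G : groupType) (f : S -> G) :=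
  isUMagmaMorphism.Build fgroup G (flift f) (flift_monoid_morphism f).

Definition fgen (s : S) : fgroup := \pi_fgroup [:: (true, s)].

Lemma flift_gen (G : groupType) (f : S -> G) s : flift f (fgen s) = f s.
Proof. by rewrite /flift feval_repr /feval big_seq1. Qed.

Lemma fgroup_ext (G : groupType) (f g : {ghom fgroup -> G}) :
  (forall s, f (fgen s) = g (fgen s)) -> f =1 g.
Proof.
move=> fg; elim/quotW; elim=> [|[b s] u IH].
  by rewrite -[\pi_fgroup _]/(1 : fgroup) !gmulf1.
have -> : \pi_fgroup ((b, s) :: u) =
    (if b then fgen s else (fgen s)^-1) * \pi_fgroup u.
  apply: fgroup_inj => G' f'; rewrite gmulfM /= [LHS]feval_repr.
  rewrite [X in _ * X]feval_repr /feval big_cons; congr (_ * _).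
  by case: b; rewrite ?gmulfV /= flift_gen.
by rewrite !gmulfM IH; case: b; rewrite ?gmulfV fg.
Qed.
End FreeGroup.

Definition fmap (S T : choiceType) (f : S -> T) : {ghom fgroup S -> fgroup T} :=
  flift (@fgen T \o f).

Lemma fmap_gen (S T : choiceType) (f : S -> T) s : fmap f (fgen s) = fgen (f s).
Proof. exact: flift_gen. Qed.

Lemma fmap_id (S : choiceType) (f : S -> S) : f =1 id -> fmap f =1 id.
Proof.
by move=> fE x; apply: (fgroup_ext (g := idfun)) x => s; rewrite fmap_gen fE.
Qed.

Lemma fmap_comp (S T U : choiceType) (f : T -> U) (g : S -> T) (h : S -> U) x :
  (forall s, f (g s) = h s) -> fmap f (fmap g x) = fmap h x.
Proof.
move=> fgE; apply: (fgroup_ext (f := fmap f \o fmap g)) x => s.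
by rewrite /= !fmap_gen fgE.
Qed.

Lemma fmap_sq (S T T' U : choiceType) (f : T -> U) (g : S -> T) (f' : T' -> U)
    (g' : S -> T') x :
  (forall s, f (g s) = f' (g' s)) -> fmap f (fmap g x) = fmap f' (fmap g' x).
Proof. by move=> fgE; rewrite !(fmap_comp (h := f' \o g')). Qed.

Definition feps (G : groupType) : {ghom fgroup G -> G} := flift id.

Lemma feps_gen (G : groupType) (x : G) : feps G (fgen x) = x.
Proof. exact: flift_gen. Qed.

Lemma feps_nat (G H : groupType) (f : {ghom G -> H}) x :
  feps H (fmap f x) = f (feps G x).
Proof.
apply: (fgroup_ext (f := feps H \o fmap f) (g := f \o feps G)) x => s.
by rewrite /= fmap_gen !feps_gen.
Qed.

Fixpoint ftower (p : nat) (G : groupType) : groupType :=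
  if p is p'.+1 then fgroup (ftower p' G) else G.

Fixpoint tmap (p : nat) (G H : groupType) (f : {ghom G -> H}) :
    {ghom ftower p G -> ftower p H} :=
  match p return {ghom ftower p G -> ftower p H} with
  | p'.+1 => fmap (tmap p' f)
  | 0 => f
  end.

(** For positive [p] this is a morphism even if [f] is a mere function, which is what lets set-level
    contractions act on the terms with p >= 1. *)
Fixpoint tfun (p : nat) (G H : groupType) (f : G -> H) :
    ftower p G -> ftower p H :=
  match p return ftower p G -> ftower p H with
  | p'.+1 => fmap (@tfun p' G H f)
  | 0 => f
  end.

Arguments tfun p {G H} f x.

(** For i <= p this is F^i applied to the counit at F^(p-i) G, the i-th face of the cotriple
    resolution; a larger index gives the last face again. *)
Fixpoint tface (p : nat) (i : nat) (G : groupType) :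
    {ghom ftower p.+1 G -> ftower p G} :=
  match p, i return {ghom ftower p.+1 G -> ftower p G} with
  | p'.+1, i'.+1 => fmap (tface p' i' G)
  | p', _ => feps (ftower p' G)
  end.

Lemma tfun_sq p (G H H' K : groupType) (f : H -> K) (g : G -> H)
    (f' : H' -> K) (g' : G -> H') x :
  (forall s, f (g s) = f' (g' s)) ->
  tfun p f (tfun p g x) = tfun p f' (tfun p g' x).
Proof.
by move=> fgE; elim: p x => [|p IH] x //=; apply: fmap_sq.
Qed.

Lemma tfun_can p (G H : groupType) (f : H -> G) (g : G -> H) :
  cancel g f -> cancel (tfun p g) (tfun p f).
Proof.
move=> gK; elim: p => [|p IH] //= x.
by rewrite (fmap_comp (h := id)) ?fmap_id.
Qed.

Lemma tmapE p (G H : groupType) (f : {ghom G -> H}) x : tmap p f x = tfun p f x.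
Proof.
elim: p x => [|p IH] //= x.
apply: (fgroup_ext (f := fmap (tmap p f)) (g := fmap (tfun p f))) => s.
by rewrite !fmap_gen IH.
Qed.

Lemma tmap_sq p (G H H' K : groupType) (f : {ghom H -> K}) (g : {ghom G -> H})
    (f' : {ghom H' -> K}) (g' : {ghom G -> H'}) x :
  (forall s, f (g s) = f' (g' s)) ->
  tmap p f (tmap p g x) = tmap p f' (tmap p g' x).
Proof. by move=> fgE; rewrite !tmapE (tfun_sq _ fgE). Qed.

Lemma tmap_can p (G H : groupType) (f : {ghom H -> G}) (g : {ghom G -> H}) :
  cancel g f -> cancel (tmap p g) (tmap p f).
Proof. by move=> gK x; rewrite !tmapE tfun_can. Qed.

Lemma tface_nat p i (G H : groupType) (f : {ghom G -> H}) x :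
  tface p i H (tmap p.+1 f x) = tmap p f (tface p i G x).
Proof.
elim: p i x => [|p IH] [|i] x; try exact: feps_nat.
by apply: fmap_sq => s; exact: IH.
Qed.

Lemma tface_tface p i j (G : groupType) x : i < j <= p.+1 ->
  tface p i G (tface p.+1 j G x) = tface p j.-1 G (tface p.+1 i G x).
Proof.
elim: p i j x => [|p IH] [|i] [|j] x // ij; try exact: feps_nat.
case: j ij => [|j] // ij.
by apply: fmap_sq => s; exact: (IH i j.+1).
Qed.

Section TowerSection.
Variables (G : groupType) (s : {ghom G -> fgroup G}).
Hypothesis sK : cancel s (feps G).

(** The section is inserted at the innermost place, so it splits the last face and commutes with all
    others: an extra degeneracy at the end. *)
Fixpoint tsec p : {ghom ftower p G -> ftower p.+1 G} :=
  match p return {ghom ftower p G -> ftower p.+1 G} with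
  | p'.+1 => fmap (tsec p')
  | 0 => s
  end.

Lemma tsecK p : cancel (tsec p) (tface p p G).
Proof.
elim: p => [|p IH] //= x.
by rewrite (fmap_comp (h := id)) ?fmap_id.
Qed.

Lemma tface_tsec p i x : i <= p ->
  tface p.+1 i G (tsec p.+1 x) = tsec p (tface p i G x).
Proof.
elim: p i x => [|p IH] [|i] x ip //; try exact: feps_nat.
by apply: fmap_sq => u; exact: IH.
Qed.
End TowerSection.

(** An alias that carries the additive structure, while [ab G] keeps its multiplicative one. *)
Definition abz (G : groupType) : Type := ab G.
HB.instance Definition _ G := Choice.on (abz G).

Section AbelianAdditive.
Variable G : groupType.

Fact abz_addrC : commutative (fun x y : ab G => x * y).
Proof.
elim/ab_elim=> x; elim/ab_elim=> y; rewrite -!gmulfM; apply/quo_eqP.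
have -> : (x * y) / (y * x) = [~ x^-1, y^-1].
  by rewrite commgEl conjgE !invgK invgM !mulgA.
exact: derived_commg.
Qed.

HB.instance Definition _ := GRing.isZmodule.Build (abz G)
  (@mulgA (ab G)) abz_addrC (@mul1g (ab G)) (@mulVg (ab G)).
End AbelianAdditive.

Section AbelianAdditiveMap.
Variables (G H : groupType) (f : {ghom G -> H}).

Definition abz_map (x : abz G) : abz H := ab_map f x.

Fact abz_map_is_zmod_morphism : zmod_morphism abz_map.
Proof. by move=> x y; exact: gmulfF. Qed.

HB.instance Definition _ :=
  GRing.isZmodMorphism.Build (abz G) (abz H) abz_map abz_map_is_zmod_morphism.
End AbelianAdditiveMap.

Lemma abz_map_comp (G H K : groupType) (f : {ghom H -> K}) (g : {ghom G -> H})
    (h : {ghom G -> K}) x :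
  (forall s, f (g s) = h s) -> abz_map f (abz_map g x) = abz_map h x.
Proof. by move=> fgE; elim/ab_elim: x => x; rewrite /abz_map !ab_mapE fgE. Qed.

Lemma abz_map_sq (G H H' K : groupType) (f : {ghom H -> K}) (g : {ghom G -> H})
    (f' : {ghom H' -> K}) (g' : {ghom G -> H'}) x :
  (forall s, f (g s) = f' (g' s)) ->
  abz_map f (abz_map g x) = abz_map f' (abz_map g' x).
Proof. by move=> fgE; rewrite !(abz_map_comp (h := f' \o g')). Qed.

Lemma abz_map_can (G H : groupType) (f : {ghom H -> G}) (g : {ghom G -> H}) :
  cancel g f -> cancel (abz_map g) (abz_map f).
Proof. by move=> gK; elim/ab_elim=> x; rewrite /abz_map !ab_mapE gK. Qed.

(** * Alternating sums and multicomplexes *)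

Section AlternatingSums.
Local Open Scope ring_scope.

Definition sg (V : zmodType) (b : bool) (x : V) : V := if b then - x else x.

Lemma sg0 (V : zmodType) b : sg b 0 = 0 :> V.
Proof. by case: b; rewrite /= ?oppr0. Qed.

Lemma sgD (V : zmodType) b : {morph @sg V b : x y / x + y}.
Proof. by case: b => x y //=; rewrite opprD. Qed.

Lemma sgN (V : zmodType) b (x : V) : sg b (- x) = - sg b x.
Proof. by case: b. Qed.

Lemma sgK (V : zmodType) b : involutive (@sg V b).
Proof. by case: b => x //=; rewrite opprK. Qed.

Lemma sg_negb (V : zmodType) b (x : V) : sg (~~ b) x = - sg b x.
Proof. by case: b; rewrite /= ?opprK. Qed.

Lemma sgC (V : zmodType) b c (x : V) : sg b (sg c x) = sg c (sg b x).
Proof. by case: b; case: c. Qed.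

Lemma sg_eq0 (V : zmodType) b (x : V) : sg b x = 0 -> x = 0.
Proof. by move=> /(congr1 (sg b)); rewrite sgK sg0. Qed.

Lemma raddf_sg (U V : zmodType) (f : {additive U -> V}) b x :
  f (sg b x) = sg b (f x).
Proof. by case: b; rewrite /= ?raddfN. Qed.

Lemma sg_sum (V : zmodType) b I (r : seq I) (P : pred I) (F : I -> V) :
  sg b (\sum_(i <- r | P i) F i) = \sum_(i <- r | P i) sg b (F i).
Proof. exact: (big_morph _ (@sgD V b) (sg0 V b)). Qed.

(** The terms with j <= i cancel those with i < j: writing j = k + 1, the hypothesis turns F i (k +
    1) into F k i, with the opposite sign. *)
Lemma alternating_double_sum (V : zmodType) n (F : nat -> nat -> V) :
  (forall i j : nat, (i < j <= n)%N -> F i j = F j.-1 i) ->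
  \sum_(i < n) sg (odd i) (\sum_(j < n.+1) sg (odd j) (F i j)) = 0.
Proof.
move=> FF; pose G (i j : nat) := sg (odd i) (sg (odd j) (F i j)).
transitivity (\sum_(i < n) \sum_(j < n | (j <= i)%N) G i j +
              \sum_(i < n) \sum_(k < n | (i <= k)%N) G i k.+1).
  rewrite -big_split /=; apply: eq_bigr => i _.
  rewrite sg_sum (bigID (fun j : 'I_n.+1 => (j <= i)%N)) /=; congr (_ + _).
    by rewrite big_mkcond big_ord_recr /= leqNgt ltn_ord addr0 -big_mkcond.
  rewrite big_mkcond big_ord_recl /= add0r -big_mkcond.
  by apply: eq_big => [k|k _]; rewrite /bump /= add1n // -ltnNge.
rewrite (exchange_big_dep xpredT) //= -big_split big1 //= => k _.
rewrite -big_split big1 //= => i ik.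
by rewrite /G (FF k i.+1) ?ltnS ?ik ?ltn_ord //= sg_negb sgN sgC subrr.
Qed.

Section Boundary.
Variables (C : nat -> zmodType) (d : forall n, nat -> {additive C n.+1 -> C n}).

(** Indices are shifted by one: [C 0] is the augmentation and [C n.+1] has the n + 1 faces of
    simplicial degree n. *)
Definition bd n (x : C n.+1) : C n := \sum_(i < n.+1) sg (odd i) (d n i x).

Fact bd_is_zmod_morphism n : zmod_morphism (@bd n).
Proof.
move=> x y; rewrite /bd -sumrB; apply: eq_bigr => i _.
by rewrite raddfB sgD sgN.
Qed.

HB.instance Definition _ n :=
  GRing.isZmodMorphism.Build (C n.+1) (C n) (@bd n) (@bd_is_zmod_morphism n).

Lemma bd_bd n (x : C n.+2) :
  (forall i j : nat, (i < j <= n.+1)%N ->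
    d n i (d n.+1 j x) = d n j.-1 (d n.+1 i x)) -> bd (bd x) = 0.
Proof.
move=> dd; rewrite -[RHS](alternating_double_sum dd); apply: eq_bigr => i _.
by rewrite raddf_sum; congr sg; apply: eq_bigr => j _; rewrite raddf_sg.
Qed.

Lemma bd_contraction0 (h : C 0 -> C 1) x : d 0 0 (h x) = x -> bd (h x) = x.
Proof. by move=> hx; rewrite /bd big_ord1. Qed.

(** An extra degeneracy in front; on a cycle the last term vanishes, so that [h x] bounds [x]. *)
Lemma bd_contraction n (h : {additive C n.+1 -> C n.+2})
    (h' : {additive C n -> C n.+1}) x :
  d n.+1 0 (h x) = x ->
  (forall i : nat, (i <= n)%N -> d n.+1 i.+1 (h x) = h' (d n i x)) ->
  bd (h x) = x - h' (bd x).
Proof.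
move=> h0 hS; rewrite /bd big_ord_recl /= h0; congr (_ + _).
rewrite raddf_sum -sumrN; apply: eq_bigr => i _.
have ni : (i <= n)%N by rewrite -ltnS.
by rewrite /bump /= add1n (hS i) // sg_negb (raddf_sg h').
Qed.

(** For an extra degeneracy at the end, [x] comes from the last face and inherits its sign. *)
Lemma bd_back_contraction n (h : {additive C n.+1 -> C n.+2})
    (h' : {additive C n -> C n.+1}) x :
  d n.+1 n.+1 (h x) = x ->
  (forall i : nat, (i <= n)%N -> d n.+1 i (h x) = h' (d n i x)) ->
  bd (h x) = h' (bd x) + sg (odd n.+1) x.
Proof.
move=> h0 hS; rewrite /bd big_ord_recr /= h0; congr (_ + _).
rewrite raddf_sum; apply: eq_bigr => i _.
have ni : (i <= n)%N by rewrite -ltnS.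
by rewrite /= (hS i) // (raddf_sg h').
Qed.
End Boundary.

Lemma bd_nat (C C' : nat -> zmodType)
    (d : forall n, nat -> {additive C n.+1 -> C n})
    (d' : forall n, nat -> {additive C' n.+1 -> C' n})
    n (f : {additive C n.+1 -> C' n.+1}) (g : {additive C n -> C' n}) x :
  (forall i : nat, (i <= n)%N -> g (d n i x) = d' n i (f x)) ->
  g (bd d x) = bd d' (f x).
Proof.
move=> gf; rewrite raddf_sum; apply: eq_bigr => i _.
by rewrite raddf_sg gf // -ltnS.
Qed.
End AlternatingSums.

(** * Total complex of a square of double complexes *)

Inductive corner := cK | cL | cR | cS.
Inductive edge := ea | eb | eg | ed.

Definition src e := match e with ea | eb => cK | eg => cR | ed => cL end.
Definition tgt e := match e with ea => cL | eb => cR | eg | ed => cS end.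

(** The homological degree of each corner in K -> L + R -> S; the total kernel is the kernel of the
    first map, in degree 2. *)
Definition wt c := match c with cK => 2 | cS => 0 | _ => 1 end%N.

Section MultiComplex.
Local Open Scope ring_scope.

(** The intended terms are the ab (F^p K_(q-1)) for q >= 1 and the augmentations ab (F^p G) for q =
    0. Exactness is recorded by the functions [hq] and [hp], which invert the differentials on
    cycles. The last two fields state that K -> L + R -> S is exact at L + R and at S for p = 0, q
    >= 1. *)
Record mcx := Mcx {
  mobj :> corner -> nat -> nat -> zmodType;
  dp : forall c p q, {additive mobj c p.+1 q -> mobj c p q};
  dq : forall c p q, {additive mobj c p q.+1 -> mobj c p q};
  ce : forall e p q, {additive mobj (src e) p q -> mobj (tgt e) p q};
  dp_dp : forall c p q (x : mobj c p.+2 q), dp c p q (dp c p.+1 q x) = 0;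
  dq_dq : forall c p q (x : mobj c p q.+2), dq c p q (dq c p q.+1 x) = 0;
  dp_dq : forall c p q (x : mobj c p.+1 q.+1),
    dp c p q (dq c p.+1 q x) = dq c p q (dp c p q.+1 x);
  ce_dp : forall e p q x, ce e p q (dp _ p q x) = dp _ p q (ce e p.+1 q x);
  ce_dq : forall e p q x, ce e p q (dq _ p q x) = dq _ p q (ce e p q.+1 x);
  ce_comm : forall p q x, ce eg p q (ce eb p q x) = ce ed p q (ce ea p q x);
  hq : forall c p q, mobj c p.+1 q -> mobj c p.+1 q.+1;
  dq_hq0 : forall c p x, dq c p.+1 0 (hq x) = x;
  dq_hq : forall c p q x, dq c p.+1 q x = 0 -> dq c p.+1 q.+1 (hq x) = x;
  hp : forall c p q, mobj c p q.+1 -> mobj c p.+1 q.+1;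
  dp_hp0 : forall c q x, dp c 0 q.+1 (hp x) = x;
  dp_hp : forall c p q x, dp c p q.+1 x = 0 -> dp c p.+1 q.+1 (hp x) = x;
  ce_surj : forall q (y : mobj cS 0 q.+1), exists x, ce eg 0 q.+1 x = y;
  ce_pullback : forall q (y : mobj cL 0 q.+1) (z : mobj cR 0 q.+1),
    ce eg 0 q.+1 z = ce ed 0 q.+1 y ->
    exists2 x, ce ea 0 q.+1 x = y & ce eb 0 q.+1 x = z
}.

Global Arguments dp {m c p q}.
Global Arguments dq {m c p q}.
Global Arguments ce {m} e {p q}.
Global Arguments hq {m c p q}.
Global Arguments hp {m c p q}.

(** A chain is a family over all entries, with its degree imposed separately by [hom]; this avoids
    casts between entries of equal total degree. *)
Definition fam (A : mcx) := forall c p q, A c p q.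

Section Total.
Variable A : mcx.
Implicit Types x y w z : fam A.

Definition Dc x c p q : A c p q :=
  match c return A c p q with
  | cK => 0
  | cL => ce ea (x cK p q)
  | cR => ce eb (x cK p q)
  | cS => ce eg (x cR p q) - ce ed (x cL p q)
  end.

(** The signs make the three commuting differentials anticommute. *)
Definition D x : fam A := fun c p q =>
  Dc x c p q + sg (odd (wt c)) (dp (x c p.+1 q) + sg (odd p) (dq (x c p q.+1))).

Definition hom n x := forall c p q, (wt c + p + q)%N != n -> x c p q = 0.

Definition fadd x y : fam A := fun c p q => x c p q + y c p q.
Definition fopp x : fam A := fun c p q => - x c p q.
Definition fzero : fam A := fun c p q => 0.

Lemma D_add x y c p q : D (fadd x y) c p q = D x c p q + D y c p q.
Proof.
rewrite /D /fadd /= !raddfD /= addrACA; congr (_ + _).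
  case: c => /=; rewrite ?addr0 //; try exact: raddfD.
  by rewrite (raddfD (ce eg)) (raddfD (ce ed)) opprD addrACA.
by rewrite -sgD addrACA -sgD.
Qed.

Lemma D_opp x c p q : D (fopp x) c p q = - D x c p q.
Proof.
rewrite /D /fopp opprD -sgN opprD -sgN !raddfN; congr (_ + _).
case: c => /=; rewrite ?oppr0 //; try exact: raddfN.
by rewrite (raddfN (ce eg)) (raddfN (ce ed)) opprD.
Qed.

Lemma D_zero c p q : D fzero c p q = 0.
Proof.
rewrite /D /fzero !raddf0 sg0 addr0 sg0 addr0.
by case: c; rewrite /= ?raddf0 ?addr0.
Qed.

Lemma hom_add n x y : hom n x -> hom n y -> hom n (fadd x y).
Proof. by move=> hx hy c p q cpq; rewrite /fadd hx // hy // addr0. Qed.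

Lemma hom_opp n x : hom n x -> hom n (fopp x).
Proof. by move=> hx c p q cpq; rewrite /fopp hx // oppr0. Qed.

Lemma hom_zero n : hom n fzero.
Proof. by []. Qed.

Lemma hom_D n x : hom n.+1 x -> hom n (D x).
Proof.
move=> hx c p q cpq; rewrite /D !(hx c) ?raddf0 ?addnS ?addSn //.
rewrite sg0 addr0 sg0 addr0; case: c cpq => //= cpq; rewrite !hx ?raddf0 ?addr0 //.
Qed.

Let Dpq x : fam A := fun c p q => dp (x c p.+1 q) + sg (odd p) (dq (x c p q.+1)).

Lemma D_D x c p q : D (D x) c p q = 0.
Proof.
have Dpq_add y z c' p' q' : Dpq (fadd y z) c' p' q' = Dpq y c' p' q' + Dpq z c' p' q'.
  by rewrite /Dpq /fadd !raddfD sgD addrACA.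
have DcDc : Dc (Dc x) c p q = 0.
  by case: c; rewrite /= ?raddf0 // ce_comm subrr.
have DpqDpq : Dpq (Dpq x) c p q = 0.
  rewrite /Dpq !raddfD !raddf_sg dp_dp dq_dq !sg0 add0r addr0 dp_dq /= sg_negb.
  by rewrite addNr.
have DcDpq : Dpq (Dc x) c p q = Dc (Dpq x) c p q.
  rewrite /Dpq; case: c {DcDc DpqDpq} => /=.
  - by rewrite !raddf0 sg0 addr0.
  - by rewrite (raddfD (ce ea)) (raddf_sg (ce ea)) ce_dp ce_dq.
  - by rewrite (raddfD (ce eb)) (raddf_sg (ce eb)) ce_dp ce_dq.
  rewrite (raddfB dp) (raddfB dq) (raddfD (ce eg)) (raddfD (ce ed)).
  by rewrite !(raddf_sg (ce _)) !ce_dp !ce_dq sgD sgN opprD addrACA.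
have Dpq_sg y b : Dpq (fun c' p' q' => sg b (y c' p' q')) c p q = sg b (Dpq y c p q).
  by rewrite /Dpq !raddf_sg sgC -sgD.
have Dc_sg y : Dc (fun c' p' q' => sg (odd (wt c')) (y c' p' q')) c p q =
    - sg (odd (wt c)) (Dc y c p q).
  case: c {DcDc DpqDpq DcDpq Dpq_sg} => //=; rewrite ?oppr0 ?opprK //.
  by rewrite (raddfN (ce eg)) (raddfN (ce ed)) opprD.
have Dc_add y z : Dc (fadd y z) c p q = Dc y c p q + Dc z c p q.
  case: c {DcDc DpqDpq DcDpq Dpq_sg Dc_sg} => /=; rewrite ?addr0 //; try exact: raddfD.
  by rewrite (raddfD (ce eg)) (raddfD (ce ed)) opprD addrACA.
transitivity (Dc (fadd (Dc x) (fun c p q => sg (odd (wt c)) (Dpq x c p q))) c p q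
  + sg (odd (wt c))
      (Dpq (fadd (Dc x) (fun c' p q => sg (odd (wt c)) (Dpq x c' p q))) c p q)) => //.
rewrite Dc_add Dpq_add Dpq_sg DpqDpq sg0 addr0 DcDpq DcDc add0r Dc_sg.
by rewrite addNr.
Qed.

Definition upset (P : nat -> nat -> bool) :=
  forall p q, P p q -> P p.+1 q /\ P p q.+1.

Lemma D_ext (P : nat -> nat -> bool) x y : upset P ->
  (forall c p q, P p q -> x c p q = y c p q) ->
  forall c p q, P p q -> D x c p q = D y c p q.
Proof.
move=> up xy c p q Ppq; have [Pp Pq] := up _ _ Ppq.
rewrite /D !xy //; congr (_ + _).
by case: c; rewrite /= ?xy.
Qed.
Lemma Dc_eq0 x c p q :
  (forall c', wt c' = (wt c).+1 -> x c' p q = 0) -> Dc x c p q = 0.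
Proof. by move=> x0; case: c x0 => //= x0; rewrite !x0 ?raddf0 ?addr0. Qed.

(** Descent along the filtration by wt c + p. In the top remaining layer, [D x = 0] reduces to
    [dq x = 0], because the corner maps and [dp] come from the layer above; [hq] then removes that
    layer. *)
Lemma exact_q n m x : hom n x ->
  (forall c p q, (0 < p)%N -> D x c p q = 0) ->
  (forall c p q, (0 < p)%N -> (m <= wt c + p)%N -> x c p q = 0) ->
  exists w, [/\ hom n.+1 w, forall c q, w c 0 q = 0
             & forall c p q, (0 < p)%N -> x c p q = D w c p q].
Proof.
elim: m x => [|m IH] x hx Dx xm.
  exists fzero; split=> [||c p q p0]; rewrite ?D_zero ?xm //; exact: hom_zero.
(* The two signs undo those that [D] puts on [dq]; the second test keeps [y] homogeneous of degree n
   + 1. *)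
pose y : fam A := fun c p q => match p, q return A c p q with
  | p'.+1, q'.+1 => if (wt c + p'.+1 == m)%N && (wt c + p'.+1 + q' == n)%N
      then sg (odd (wt c)) (sg (odd p'.+1) (hq (x c p'.+1 q'))) else 0
  | _, _ => 0 end.
have hy : hom n.+1 y.
  move=> c [|p] [|q] //=; rewrite addnS eqSS => /negPf ->.
  by rewrite andbF.
have y0 c q : y c 0 q = 0 by [].
have ym c p q : (m < wt c + p)%N -> y c p q = 0.
  by case: p q => [|p] [|q] //= mp; rewrite (gtn_eqF mp).
have Dy c p q : (0 < p)%N -> (m <= wt c + p)%N -> D y c p q = x c p q.
  case: p => // p _ mp; rewrite /D Dc_eq0 => [|c' cc']; last first.
    by rewrite ym // cc' addSn ltnS.
  rewrite add0r (ym c p.+2 q) ?raddf0 ?add0r; last by rewrite addnS ltnS.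
  rewrite [y _ _ _]/=; case: ifP => [/andP[/eqP cpm /eqP cpq]|]; last first.
    rewrite raddf0 !sg0 => mn; case: (ltnP m (wt c + p.+1)) => [mlt|mge].
      by rewrite xm.
    rewrite hx //; apply/negP => cpq; move: mn.
    by rewrite cpq andbT eqn_leq mge mp.
  rewrite !(raddf_sg dq) (sgC (odd (wt c))) !sgK.
  case: q {cpq} => [|q]; first exact: dq_hq0.
  apply: dq_hq; apply: (@sg_eq0 _ (odd p.+1)); apply: (@sg_eq0 _ (odd (wt c))).
  rewrite -[RHS](Dx c p.+1 q) // /D Dc_eq0 ?add0r => [|c' cc'].
    by rewrite (xm c p.+2 q) ?raddf0 ?add0r // addnS cpm.
  by rewrite xm // cc' addSn cpm.
have [||c p q p0 mp|w [hw w0 xw]] := IH (fadd x (fopp (D y))).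
- exact/hom_add/hom_opp/hom_D.
- by move=> c p q p0; rewrite D_add D_opp D_D Dx // oppr0 addr0.
- by rewrite /fadd /fopp Dy // subrr.
exists (fadd w y); split=> [|c q|c p q p0]; first exact: hom_add.
  by rewrite /fadd w0 y0 addr0.
by rewrite D_add -xw // /fadd /fopp addrNK.
Qed.

(** The descent of [exact_q] with the directions exchanged: the layers are those of wt c + q, and
    [hp] removes them. *)
Lemma exact_p n m x : hom n x ->
  (forall c p q, (0 < q)%N -> D x c p q = 0) ->
  (forall c p q, (0 < q)%N -> (m <= wt c + q)%N -> x c p q = 0) ->
  exists w, [/\ hom n.+1 w, forall c p, w c p 0 = 0
             & forall c p q, (0 < q)%N -> x c p q = D w c p q].
Proof.
elim: m x => [|m IH] x hx Dx xm.
  exists fzero; split=> [||c p q q0]; rewrite ?D_zero ?xm //; exact: hom_zero.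
pose y : fam A := fun c p q => match p, q return A c p q with
  | p'.+1, q'.+1 => if (wt c + q'.+1 == m)%N && (wt c + p' + q'.+1 == n)%N
      then sg (odd (wt c)) (hp (x c p' q'.+1)) else 0
  | _, _ => 0 end.
have hy : hom n.+1 y.
  move=> c [|p] [|q] //=; rewrite [(wt c + p.+1)%N]addnS addSn eqSS => /negPf ->.
  by rewrite andbF.
have y0 c p : y c p 0 = 0 by case: p.
have ym c p q : (m < wt c + q)%N -> y c p q = 0.
  by case: p q => [|p] [|q] //= mp; rewrite (gtn_eqF mp).
have Dy c p q : (0 < q)%N -> (m <= wt c + q)%N -> D y c p q = x c p q.
  case: q => // q _ mp; rewrite /D Dc_eq0 => [|c' cc']; last first.
    by rewrite ym // cc' addSn ltnS.
  rewrite add0r (ym c p q.+2) ?raddf0 ?sg0 ?addr0; last by rewrite addnS ltnS.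
  rewrite [y _ _ _]/=; case: ifP => [/andP[/eqP cpm /eqP cpq]|]; last first.
    rewrite raddf0 !sg0 => mn; case: (ltnP m (wt c + q.+1)) => [mlt|mge].
      by rewrite xm.
    rewrite hx //; apply/negP => cpq; move: mn.
    by rewrite cpq andbT eqn_leq mge mp.
  rewrite (raddf_sg dp) sgK.
  case: p {cpq} => [|p]; first exact: dp_hp0.
  apply: dp_hp; apply: (@sg_eq0 _ (odd (wt c))).
  rewrite -[RHS](Dx c p q.+1) // /D Dc_eq0 ?add0r => [|c' cc'].
    by rewrite (xm c p q.+2) ?raddf0 ?sg0 ?addr0 // addnS cpm.
  by rewrite xm // cc' addSn cpm.
have [||c p q q0 mp|w [hw w0 xw]] := IH (fadd x (fopp (D y))).
- exact/hom_add/hom_opp/hom_D.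
- by move=> c p q q0; rewrite D_add D_opp D_D Dx // oppr0 addr0.
- by rewrite /fadd /fopp Dy // subrr.
exists (fadd w y); split=> [|c p|c p q q0]; first exact: hom_add.
  by rewrite /fadd w0 y0 addr0.
by rewrite D_add -xw // /fadd /fopp addrNK.
Qed.
(** Three corrections: [w0] clears p > 0 by exactness in the direction q, [w1] clears the corner S
    by surjectivity, and [w2] clears L and R by the pullback property. What is left sits at K, and
    the vanishing of [D z] at L and R puts it in the total kernel. *)
Lemma reduce_kernel n z : hom n z ->
  (forall c p q, (0 < p)%N -> D z c p q = 0) ->
  (forall c q, c <> cK -> D z c 0 q.+1 = 0) ->
  exists w s, [/\ hom n.+1 w, hom n s,
    forall c p q, (0 < p)%N \/ c <> cK -> s c p q = 0,
    forall q, ce ea (s cK 0 q.+1) = 0 /\ ce eb (s cK 0 q.+1) = 0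
  & forall c p q, (0 < p + q)%N -> z c p q = D w c p q + s c p q].
Proof.
move=> hz Dz_p Dz_q.
have [c p q p0 np|w0 [hw0 _ zw0]] := exact_q (m := n.+1) hz Dz_p.
  by rewrite hz // neq_ltn (leq_trans np) ?leq_addr // orbT.
pose z1 := fadd z (fopp (D w0)).
have z1p c p q : (0 < p)%N -> z1 c p q = 0.
  by move=> p0; rewrite /z1 /fadd /fopp zw0 // subrr.
have hz1 : hom n z1 by exact/hom_add/hom_opp/hom_D.
have Dz1 c p q : D z1 c p q = D z c p q.
  by rewrite D_add D_opp D_D oppr0 addr0.
pose r q := projT1 (cid (ce_surj (z1 cS 0 q.+1))).
have rE q : ce eg (r q) = z1 cS 0 q.+1 := projT2 (cid (ce_surj (z1 cS 0 q.+1))).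
(* At R the index q' + 1 has total degree q' + 2, which must be n + 1; at K, for [w2] below, it has
   degree q' + 3. *)
pose w1 : fam A := fun c p q => match c, p, q return A c p q with
  | cR, 0%N, q'.+1 => if q'.+1 == n then r q' else 0
  | _, _, _ => 0 end.
have hw1 : hom n.+1 w1.
  by case=> [] [|p] [|q] //=; rewrite addn0 add1n eqSS => /negPf->.
have w1p c p q : w1 c p.+1 q = 0 by case: c.
pose z2 := fadd z1 (fopp (D w1)).
have z2p c p q : (0 < p)%N -> z2 c p q = 0.
  move=> p0; rewrite /z2 /fadd /fopp z1p // add0r; case: p p0 => // p _.
  rewrite /D Dc_eq0 => [|c' _]; last exact: w1p.
  by rewrite !w1p !raddf0 sg0 addr0 add0r sg0 oppr0.
have hz2 : hom n z2 by exact/hom_add/hom_opp/hom_D.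
have Dz2 c p q : D z2 c p q = D z c p q.
  by rewrite D_add D_opp D_D oppr0 addr0.
have z2S q : z2 cS 0 q.+1 = 0.
  rewrite /z2 /fadd /fopp /D /= !raddf0 !addr0; case: eqP => [_|qn].
    by rewrite rE subrr.
  by rewrite hz1 ?raddf0 ?addr0 //= add0n; apply/eqP.
(* With the S entries gone, the vanishing of [D z] at S says that the L and R entries agree over
   S. *)
have z2LR q : ce eg (z2 cR 0 q.+1) = ce ed (z2 cL 0 q.+1).
  apply: subr0_eq; rewrite -[RHS](Dz_q cS q) // -Dz2 /D /=.
  by rewrite (z2p cS 1) // !z2S !raddf0 !addr0.
pose k q := s2val (cid2 (ce_pullback (z2LR q))).
have ka q : ce ea (k q) = z2 cL 0 q.+1 := s2valP (cid2 (ce_pullback (z2LR q))).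
have kb q : ce eb (k q) = z2 cR 0 q.+1 := s2valP' (cid2 (ce_pullback (z2LR q))).
pose w2 : fam A := fun c p q => match c, p, q return A c p q with
  | cK, 0%N, q'.+1 => if q'.+2 == n then k q' else 0
  | _, _, _ => 0 end.
have hw2 : hom n.+1 w2.
  by case=> [] [|p] [|q] //=; rewrite addn0 add2n eqSS => /negPf->.
have w2p c p q : w2 c p.+1 q = 0 by case: c.
pose z3 := fadd z2 (fopp (D w2)).
have z3p c p q : (0 < p)%N -> z3 c p q = 0.
  move=> p0; rewrite /z3 /fadd /fopp z2p // add0r; case: p p0 => // p _.
  rewrite /D Dc_eq0 => [|c' _]; last exact: w2p.
  by rewrite !w2p !raddf0 sg0 addr0 add0r sg0 oppr0.
have hz3 : hom n z3 by exact/hom_add/hom_opp/hom_D.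
have Dz3 c p q : D z3 c p q = D z c p q.
  by rewrite D_add D_opp D_D oppr0 addr0.
have z3q c q : c <> cK -> z3 c 0 q.+1 = 0.
  rewrite /z3 /fadd /fopp /D; case: c => //= _.
  - rewrite !raddf0 !addr0 oppr0 addr0; case: eqP => [_|qn].
      by rewrite ka subrr.
    by rewrite hz2 ?raddf0 ?addr0 //= addn0 add1n; apply/eqP.
  - rewrite !raddf0 !addr0 oppr0 addr0; case: eqP => [_|qn].
      by rewrite kb subrr.
    by rewrite hz2 ?raddf0 ?addr0 //= addn0 add1n; apply/eqP.
  by rewrite z2S !raddf0 !addr0 ?oppr0 ?addr0.
(* Off K, the entries of [z3] at p = q = 0 are not controlled; they are dropped, and the last claim
   excludes them. *)
pose s : fam A := fun c p q => match c, p return A c p q with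
  | cK, 0%N => z3 cK 0 q
  | _, _ => 0 end.
exists (fadd w0 (fadd w1 w2)), s; split.
- exact/hom_add/hom_add.
- by case=> [] [|p] q cpq //=; exact: hz3.
- by case=> [] [|p] q [].
- move=> q /=; split.
    rewrite -[RHS](Dz_q cL q) // -Dz3 /D /=.
    by rewrite (z3q cL) // (z3p cL 1) // !raddf0 addr0 oppr0 addr0.
  rewrite -[RHS](Dz_q cR q) // -Dz3 /D /=.
  by rewrite (z3q cR) // (z3p cR 1) // !raddf0 addr0 oppr0 addr0.
move=> c p q pq; rewrite !D_add.
have -> : s c p q = z3 c p q.
  case: p pq => [|p] pq; last by rewrite z3p //; case: c.
  by case: q pq => // q _; case: c => //=; rewrite z3q.
rewrite /z3 /z2 /z1 /fadd /fopp [RHS]addrC (addrC (D w1 c p q)) (addrC (D w0 c p q)).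
move: (D w0 c p q) (D w1 c p q) (D w2 c p q) => a0 a1 a2.
by rewrite !addrA !addrNK.
Qed.

Definition ksupp x := forall c p q, (0 < p)%N \/ c <> cK -> x c p q = 0.
Definition kern x := forall q, ce ea (x cK 0 q.+1) = 0 /\ ce eb (x cK 0 q.+1) = 0.
Definition asupp x := forall c p q, (0 < q)%N \/ p = 0%N -> x c p q = 0.

(* Equality of families disregarding the meaningless entries at p = q = 0. *)
Definition eqf x y := forall c p q, (0 < p + q)%N -> x c p q = y c p q.

Lemma eqf_D x y : eqf x y -> eqf (D x) (D y).
Proof.
apply: (D_ext (P := fun p q => (0 < p + q)%N)) => p q pq.
by rewrite addnS addSn.
Qed.

Definition kfam n x := [/\ hom n x, ksupp x & kern x].
Definition afam n x := hom n x /\ asupp x.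

(** A chain of the total kernel and a chain of the augmentation row are homologous. The existence
    and boundary lemmas below make this relation an isomorphism between the two homologies. *)
Definition linked n x a := [/\ kfam n x, afam n a
  & exists2 w, hom n.+1 w & eqf (D w) (fadd x (fopp a))].

Lemma kfam_add n x y : kfam n x -> kfam n y -> kfam n (fadd x y).
Proof.
case=> hx sx kx [hy sy ky]; split; first exact: hom_add.
  by move=> c p q cp; rewrite /fadd sx // sy // addr0.
move=> q; have [xa xb] := kx q; have [ya yb] := ky q.
by split; rewrite /fadd raddfD /= ?xa ?xb ?ya ?yb addr0.
Qed.

Lemma kfam_opp n x : kfam n x -> kfam n (fopp x).
Proof.
case=> hx sx kx; split; first exact: hom_opp.
  by move=> c p q cp; rewrite /fopp sx // oppr0.
by move=> q; have [xa xb] := kx q; split; rewrite /fopp raddfN /= ?xa ?xb oppr0.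
Qed.

Lemma afam_add n x y : afam n x -> afam n y -> afam n (fadd x y).
Proof.
case=> hx sx [hy sy]; split; first exact: hom_add.
by move=> c p q pq; rewrite /fadd sx // sy // addr0.
Qed.

Lemma afam_opp n x : afam n x -> afam n (fopp x).
Proof.
case=> hx sx; split; first exact: hom_opp.
by move=> c p q pq; rewrite /fopp sx // oppr0.
Qed.

Lemma linked_sub n x a y b : linked n x a -> linked n y b ->
  linked n (fadd x (fopp y)) (fadd a (fopp b)).
Proof.
case=> kx ka [w hw wE] [ky kb [v hv vE]]; split.
- exact/kfam_add/kfam_opp.
- exact/afam_add/afam_opp.
exists (fadd w (fopp v)); first exact/hom_add/hom_opp.
move=> c p q pq; rewrite D_add D_opp wE // vE // /fadd /fopp.
by rewrite !opprD !opprK addrACA.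
Qed.

Lemma D_kfam n x c p q : kfam n x -> (0 < p)%N \/ (0 < q)%N /\ c <> cK ->
  D x c p q = 0.
Proof.
case=> hx sx kx cpq; rewrite /D (sx c p.+1) ?raddf0 ?add0r; last by left.
case: p cpq => [[//|[]]|p _]; last first.
  rewrite Dc_eq0 => [|c' _]; last by apply: sx; left.
  by rewrite sx ?raddf0 ?sg0 ?addr0 //; left.
case: q => // q _ cK'; rewrite sx ?raddf0 ?sg0 ?addr0; last by right.
case: c cK' => //= _; try by case: (kx q) => xa xb; rewrite ?xa ?xb.
by rewrite !sx ?raddf0 ?addr0 //; right.
Qed.

Lemma D_afam n x c p q : afam n x -> (0 < q)%N -> D x c p q = 0.
Proof.
case=> hx sx q0; rewrite /D !(sx c) ?raddf0 ?sg0 ?addr0; try by left.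
by rewrite sg0 addr0 Dc_eq0 // => c' _; rewrite sx //; left.
Qed.

Let atrunc x : fam A := fun c p q =>
  match p, q return A c p q with p'.+1, 0%N => x c p'.+1 0 | _, _ => 0 end.

Let afam_atrunc n x : hom n x -> afam n (atrunc x).
Proof.
move=> hx; split; first by move=> c [|p] [|q] //; exact: hx.
by move=> c [|p] [|q] // [].
Qed.

(** Exactness in the direction p makes [x] a boundary off the row q = 0; subtracting that boundary
    leaves a chain of the row. *)
Lemma linked_of_kfam n x : kfam n x -> eqf (D x) fzero -> exists a, linked n x a.
Proof.
move=> kx Dx; have [hx sx kx'] := kx.
have [c p q q0|c p q q0 nq|w [hw _ xw]] := exact_p (m := n.+1) hx.
- by rewrite Dx // addn_gt0 q0 orbT.
- by rewrite hx // neq_ltn (leq_trans nq) ?orbT // addnAC leq_addr.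
have hxw : hom n (fadd x (fopp (D w))) by exact/hom_add/hom_opp/hom_D.
exists (atrunc (fadd x (fopp (D w)))); split=> //; first exact: afam_atrunc.
exists w => // c p q pq; rewrite /fadd /fopp.
case: q pq => [|q] pq; last first.
  by case: p pq => [|p] pq /=; rewrite oppr0 addr0 -xw.
by case: p pq => // p _; rewrite /= opprB addrC addrNK.
Qed.

Lemma linked_of_afam n a : afam n a -> eqf (D a) fzero -> exists x, linked n x a.
Proof.
move=> ka Da; have [ha sa] := ka.
have [c p q p0|c q _|w [x [hw hx sx kx aw]]] := reduce_kernel ha.
- by rewrite Da // addn_gt0 p0.
- by rewrite Da.
exists x; split=> //; exists (fopp w); first exact: hom_opp.
move=> c p q pq; rewrite D_opp /fadd /fopp aw //; move: (D w c p q) => d.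
by rewrite opprD addrCA addrN addr0.
Qed.

(** The chain u - w bounds [a], which vanishes for q > 0. Subtracting a suitable [D v] moves it into
    the row q = 0 without changing its boundary. *)
Lemma linked_boundary n x a u : linked n x a -> kfam n.+1 u -> eqf x (D u) ->
  exists2 b, afam n.+1 b & eqf a (D b).
Proof.
case=> [kx ka [w hw wE]] [hu su ku] xu.
pose z := fadd u (fopp w).
have hz : hom n.+1 z by exact/hom_add/hom_opp.
have Dz : eqf (D z) a.
  move=> c p q pq; rewrite /z D_add D_opp -xu // wE // /fadd /fopp.
  by rewrite opprD opprK addrA addrN add0r.
have [c p q q0|c p q q0 nq|v [hv _ zv]] := exact_p (m := n.+2) hz.
- by rewrite Dz ?addn_gt0 ?q0 ?orbT // ka.2 //; left.
- by rewrite hz // neq_ltn (leq_trans nq) ?orbT // addnAC leq_addr.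
have hzv : hom n.+1 (fadd z (fopp (D v))) by exact/hom_add/hom_opp/hom_D.
exists (atrunc (fadd z (fopp (D v)))); first exact: afam_atrunc.
move=> c p q pq; rewrite -Dz // -[LHS]subr0 -(D_D v c p q) -D_opp -D_add.
apply: eqf_D => // c' [|p'] [|q'] // _; rewrite /= /fadd /fopp;
  by rewrite zv ?subrr.
Qed.

(** The chain w + b bounds [x], and [reduce_kernel] moves it into the total kernel without changing
    its boundary. *)
Lemma linked_boundary' n x a b : linked n x a -> afam n.+1 b -> eqf a (D b) ->
  exists2 u, kfam n.+1 u & eqf x (D u).
Proof.
case=> [kx ka [w hw wE]] [hb sb] ab.
pose z := fadd w b.
have hz : hom n.+1 z by exact/hom_add.
have Dz : eqf (D z) x.
  move=> c p q pq; rewrite /z D_add -ab // wE // /fadd /fopp.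
  by rewrite addrNK.
have [hx sx kx'] := kx.
have [c p q p0|c q cK'|v [u [hv hu su ku zv]]] := reduce_kernel hz.
- by rewrite Dz ?addn_gt0 ?p0 // sx //; left.
- by rewrite Dz // sx //; right.
exists u => // c p q pq; rewrite -Dz // (eqf_D zv) // D_add D_D.
by rewrite add0r.
Qed.

(** The index [m.+2] is simplicial degree m + 1, so [dq t] stays above the augmentation; m = 0 is
    the case of the Schur multiplier. *)
Definition kcycle m (t : A cK 0 m.+2) := [/\ ce ea t = 0, ce eb t = 0 & dq t = 0].
Definition kbound m (t : A cK 0 m.+2) := exists u : A cK 0 m.+3,
  [/\ ce ea u = 0, ce eb u = 0 & dq u = t].

Lemma kfam_ex q (t : A cK 0 q.+1) : ce ea t = 0 -> ce eb t = 0 ->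
  exists2 x, kfam q.+3 x & x cK 0 q.+1 = t.
Proof.
move=> ta tb.
pose x : fam A := fun c p q' => match c, p return A c p q' with
  | cK, 0%N => if eqVneq q' q.+1 is EqNotNeq e
               then ecast i (A cK 0 i) (esym e) t else 0
  | _, _ => 0 end.
have xt : x cK 0 q.+1 = t.
  rewrite /x; case: eqVneq => [e|]; last by rewrite eqxx.
  by rewrite (eq_axiomK e).
have x0 q' : q' != q.+1 -> x cK 0 q' = 0.
  by rewrite /x; case: eqVneq.
exists x => //; split.
- by case=> [] [|p] q' //; rewrite addn0 add2n !eqSS; exact: x0.
- by case=> [] [|p] q' [].
move=> q'; have [->|qq'] := eqVneq q'.+1 q.+1; first by rewrite xt.
by rewrite x0 // !raddf0.
Qed.
End Total.

(** * Transport along an isomorphism of augmentation rows *)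

Section Transport.
Variables (A A' : mcx) (th : forall c p, {additive A c p.+1 0 -> A' c p.+1 0}).
Hypothesis th_dp : forall c p x, th c p (dp x) = dp (th c p.+1 x).
Hypothesis th_ce : forall e p x, th (tgt e) p (ce e x) = ce e (th (src e) p x).

Definition atrans (a : fam A) : fam A' := fun c p q =>
  match p, q return A' c p q with
  | p'.+1, 0%N => th c p' (a c p'.+1 0%N)
  | _, _ => 0 end.

Lemma afam_atrans n a : afam n a -> afam n (atrans a).
Proof.
case=> ha sa; split; last by move=> c [|p] [|q] // [].
by move=> c [|p] [|q] // cpq /=; rewrite ha ?raddf0.
Qed.

Lemma D_atrans n a : afam n.+1 a -> eqf (D (atrans a)) (atrans (D a)).
Proof.
move=> ka c p [|q] pq; last first.
  by rewrite (D_afam _ _ (afam_atrans ka)) //; case: p pq.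
case: p pq => // p _.
rewrite /D /= raddfD /= (raddf_sg (th _ _)) raddfD /= (raddf_sg (th _ _)).
rewrite (ka.2 c p.+1 1%N) ?raddf0 ?sg0 ?addr0; last by left.
rewrite th_dp; congr (_ + _).
case: c => //=; rewrite ?raddf0 //; try by rewrite -th_ce.
by rewrite raddfB -!th_ce.
Qed.

Lemma atrans_add a b : eqf (atrans (fadd a b)) (fadd (atrans a) (atrans b)).
Proof. by move=> c [|p] [|q] // _; rewrite /fadd /= ?addr0 ?raddfD. Qed.

Lemma atrans_opp a : eqf (atrans (fopp a)) (fopp (atrans a)).
Proof. by move=> c [|p] [|q] // _; rewrite /fopp /= ?oppr0 ?raddfN. Qed.
End Transport.
End MultiComplex.

Arguments kcycle {A m} t.
Arguments kbound {A m} t.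

(** * Groups presented as homology groups *)

Section Presentations.
Local Open Scope ring_scope.

Lemma subrACA (V : zmodType) (x y z t : V) : x - y - (z - t) = x - z - (y - t).
Proof. by rewrite !opprB addrACA [RHS]addrACA [- y - z]addrC. Qed.

(* [H] is the quotient of the additive group [Z] by its subgroup [B]. *)
Definition presents (H : groupType) (V : zmodType) (Z B : V -> Prop) :=
  exists k : H -> V, [/\ forall a, Z (k a),
    forall a b, B (k (a * b)%g - (k a + k b)),
    forall a b, B (k a - k b) -> a = b
  & forall v, Z v -> exists a, B (v - k a)].

Lemma presents_ext (H : groupType) (V : zmodType) (Z B Z' B' : V -> Prop) :
  presents H Z B -> (forall v, Z' v <-> Z v) -> (forall v, B' v <-> B v) ->
  presents H Z' B'.
Proof.
case=> k [kZ kM kI kS] ZE BE; exists k; split=> [a|a b|a b|v].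
- exact/ZE.
- exact/BE.
- by move=> /BE; exact: kI.
- by move=> /ZE/kS[a Ba]; exists a; apply/BE.
Qed.

Definition zsub (V : zmodType) (B : V -> Prop) :=
  B 0 /\ forall u v, B u -> B v -> B (u - v).

Lemma zsubN (V : zmodType) (B : V -> Prop) u : zsub B -> B u -> B (- u).
Proof. by case=> B0 Bs Bu; rewrite -sub0r; exact: Bs. Qed.

Lemma zsubD (V : zmodType) (B : V -> Prop) u v : zsub B -> B u -> B v -> B (u + v).
Proof. by move=> sB Bu Bv; rewrite -[v]opprK; apply: sB.2 => //; exact: zsubN. Qed.

(** Enlarging [r] by boundaries on both sides gives a relation [s] whose restriction to
    representatives is the graph of a bijection: respecting boundaries forwards makes it functional,
    backwards injective, and additivity makes it a morphism. *)
Lemma iso_of_relation (H H' : groupType) (V V' : zmodType) (Z B : V -> Prop)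
    (Z' B' : V' -> Prop) (r : V -> V' -> Prop) :
  presents H Z B -> presents H' Z' B' -> zsub B -> zsub B' ->
  r 0 0 ->
  (forall u u' v v', r u u' -> r v v' -> r (u - v) (u' - v')) ->
  (forall v, Z v -> exists2 v', Z' v' & r v v') ->
  (forall v', Z' v' -> exists2 v, Z v & r v v') ->
  (forall v v', r v v' -> B v -> B' v') ->
  (forall v v', r v v' -> B' v' -> B v) ->
  group_iso H H'.
Proof.
case=> k [kZ kM kI kS] [k' [kZ' kM' kI' kS']] sB sB' r0 rB tot tot' BB' B'B.
pose s v v' := exists u u', [/\ B (v - u), r u u' & B' (v' - u')].
have s_sub u u' v v' : s u u' -> s v v' -> s (u - v) (u' - v').
  case=> a [a' [ua raa ua']] [b [b' [vb rbb vb']]].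
  exists (a - b), (a' - b'); split; first 1 last; first exact: rB.
    by rewrite subrACA; exact: sB'.2.
  by rewrite subrACA; exact: sB.2.
have s_B v v' : s v v' -> B v <-> B' v'.
  case=> u [u' [vu ruu vu']]; split=> [Bv|Bv'].
    rewrite -[v'](subrK u'); apply: zsubD => //; apply: BB' ruu _.
    by rewrite -[u](subKr v); apply: sB.2.
  rewrite -[v](subrK u); apply: zsubD => //; apply: B'B ruu _.
  by rewrite -[u'](subKr v'); apply: sB'.2.
have s0 v v' : B v -> B' v' -> s v v'.
  by move=> Bv Bv'; exists 0, 0; rewrite !subr0.
have s_ex a : exists b, s (k a) (k' b).
  have [v' Zv' rv] := tot _ (kZ a); have [b Bb] := kS' _ Zv'.
  exists b, (k a), v'; split=> //; first by rewrite subrr; exact: sB.1.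
  by rewrite -opprB; apply: zsubN.
have s_ex' b : exists a, s (k a) (k' b).
  have [v Zv rv] := tot' _ (kZ' b); have [a Ba] := kS _ Zv.
  exists a, v, (k' b); split=> //; last by rewrite subrr; exact: sB'.1.
  by rewrite -opprB; apply: zsubN.
have s_fun a b b' : s (k a) (k' b) -> s (k a) (k' b') -> b = b'.
  move=> ab ab'; apply: kI'; apply: (s_B _ _ (s_sub _ _ _ _ ab ab')).1.
  by rewrite subrr; exact: sB.1.
have s_inj a a' b : s (k a) (k' b) -> s (k a') (k' b) -> a = a'.
  move=> ab ab'; apply: kI; apply: (s_B _ _ (s_sub _ _ _ _ ab ab')).2.
  by rewrite subrr; exact: sB'.1.
have [f fs] := choice s_ex; have [g gs] := choice s_ex'.
have sN v v' : s v v' -> s (- v) (- v').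
  by move=> /(s_sub _ _ _ _ (s0 _ _ sB.1 sB'.1)); rewrite !sub0r.
have sD u u' v v' : s u u' -> s v v' -> s (u + v) (u' + v').
  by move=> su /sN sv; rewrite -[v]opprK -[v']opprK; exact: s_sub.
have fM : {morph f : a b / (a * b)%g}.
  move=> a b; apply: (s_fun (a * b)%g) => //.
  rewrite -[k _](subrK (k a + k b)) -[k' _](subrK (k' (f a) + k' (f b))).
  by apply/sD/sD => //; exact: s0.
have f1 : f 1%g = 1%g.
  by apply: (mulgI (f 1%g)); rewrite -fM !mulg1.
pose fh : {ghom H -> H'} := HB.pack f (isUMagmaMorphism.Build H H' f (conj f1 fM)).
exists fh; exists g => [a|b].
  exact: s_inj (gs _) (fs _).
exact: s_fun (fs _) (gs _).
Qed.
End Presentations.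

Section Linked.
Local Open Scope ring_scope.
Variable A : mcx.
Implicit Types x a b : fam A.

Lemma linked_eqf n x a b : linked n x a -> afam n b -> eqf a b -> linked n x b.
Proof.
case=> kx ka [w hw wE] kb ab; split=> //; exists w => // c p q pq.
by rewrite wE // /fadd /fopp ab.
Qed.

Lemma linked_cycle n x a : linked n x a -> eqf (D a) (D x).
Proof.
case=> kx ka [w hw wE] c p q pq; apply/esym/subr0_eq.
by rewrite -D_opp -D_add -(eqf_D wE) // D_D.
Qed.

Lemma D_kfamK n x q : kfam n x -> D x cK 0 q = dq (x cK 0%N q.+1).
Proof.
by case=> hx sx kx; rewrite /D /= (sx cK 1%N) ?raddf0 ?add0r; last by left.
Qed.

Lemma linked_zero n : linked n (@fzero A) (@fzero A).
Proof.
split; last exists (@fzero A) => // c p q pq.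
- by split=> // q; rewrite !raddf0.
- by split.
- by rewrite D_zero /fadd /fopp /fzero subr0.
Qed.

Lemma kbound_zsub m : zsub (@kbound A m).
Proof.
split=> [|u v [u' [ua ub du]] [v' [va vb dv]]].
  by exists 0; split; rewrite raddf0.
by exists (u' - v'); split; rewrite raddfB /= ?ua ?ub ?va ?vb ?du ?dv ?subr0.
Qed.
End Linked.

(** * Comparison of two total kernels through their augmentation rows *)

Section Comparison.
Local Open Scope ring_scope.

(** The zigzag total kernel, row of [A], row of [A'], total kernel. The degree m + 4 is the index m
    + 2 plus the weight 2 of K. *)
Definition kerrel (A A' : mcx) (th : forall c p, {additive A c p.+1 0 -> A' c p.+1 0})
    m (t : A cK 0 m.+2) (t' : A' cK 0 m.+2) :=
  exists x a x', [/\ linked m.+4 x a, linked m.+4 x' (atrans th a),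
    x cK 0%N m.+2 = t & x' cK 0%N m.+2 = t'].

Section OneSided.
Variables (A A' : mcx) (th : forall c p, {additive A c p.+1 0 -> A' c p.+1 0}).
Hypothesis th_dp : forall c p x, th c p (dp x) = dp (th c p.+1 x).
Hypothesis th_ce : forall e p x, th (tgt e) p (ce e x) = ce e (th (src e) p x).

Lemma atrans_eqf a b : eqf a b -> eqf (atrans th a) (atrans th b).
Proof. by move=> ab c [|p] [|q] // _; rewrite /= ab. Qed.

Lemma kerrel_total m t : kcycle t -> exists2 t', kcycle t' & kerrel th (m := m) t t'.
Proof.
case=> ta tb dt; have [x kx xt] := kfam_ex ta tb.
have Dx : eqf (D x) (@fzero A).
  move=> c [|p] q pq; last by rewrite (D_kfam kx) //; left.
  have [cK'|cK'] := pselect (c = cK); last by rewrite (D_kfam kx) //; right.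
  rewrite {}cK' (D_kfamK _ kx); have [e|qm] := eqVneq q m.+1.
    by rewrite e xt.
  by case: kx => hx _ _; rewrite hx ?raddf0 // addn0 add2n !eqSS.
have [a xa] := linked_of_kfam kx Dx; have [_ ka _] := xa.
have Da : eqf (D (atrans th a)) (@fzero A').
  move=> c p q pq; rewrite (D_atrans th_dp th_ce ka) //.
  case: p q pq => [|p] [|q] //= _; rewrite (linked_cycle xa) // Dx //.
  exact: raddf0.
have [x' xa'] := linked_of_afam (afam_atrans th ka) Da.
exists (x' cK 0%N m.+2); last by exists x, a, x'.
have [kx' _ _] := xa'; have [_ _ kk] := kx'.
split; rewrite ?(kk _).1 ?(kk _).2 //.
by rewrite -(D_kfamK _ kx') -(linked_cycle xa') // Da.
Qed.

(** A bounding chain is carried along the zigzag: into the row by [linked_boundary], across by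
    [D_atrans], and back by [linked_boundary']. *)
Lemma kerrel_bound m t t' : kerrel th (m := m) t t' -> kbound t -> kbound t'.
Proof.
case=> x [a [x' [xa xa' xt xt']]] [u [ua ub du]].
have [kx ka _] := xa; have [v kv vu] := kfam_ex ua ub.
have xv : eqf x (D v).
  move=> c [|p] q pq; last first.
    by rewrite (D_kfam kv); last left; case: kx => _ sx _ //; apply: sx; left.
  have [cK'|cK'] := pselect (c = cK); last first.
    by rewrite (D_kfam kv); last right; case: kx => _ sx _ //; apply: sx; right.
  rewrite {}cK'; have [e|qm] := eqVneq q m.+2.
    by rewrite e (D_kfamK _ kv) vu xt.
  case: kx kv => hx _ _ [hv _ _]; rewrite hx ?(hom_D hv) //;
    by rewrite addn0 add2n !eqSS.
have [b kb ab] := linked_boundary xa kv xv.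
have ab' : eqf (atrans th a) (D (atrans th b)).
  by move=> c p q pq; rewrite (D_atrans th_dp th_ce kb) // (atrans_eqf ab).
have [v' kv' xv'] := linked_boundary' xa' (afam_atrans th kb) ab'.
have [_ _ kk] := kv'; exists (v' cK 0%N m.+3); split; rewrite ?(kk _).1 ?(kk _).2 //.
by rewrite -(D_kfamK _ kv') -xv'.
Qed.

Lemma kerrel_sub m t t' s s' : kerrel th (m := m) t t' -> kerrel th s s' ->
  kerrel th (t - s) (t' - s').
Proof.
case=> x [a [x' [xa xa' <- <-]]] [y [b [y' [yb yb' <- <-]]]].
exists (fadd x (fopp y)), (fadd a (fopp b)), (fadd x' (fopp y')); split=> //.
  exact: linked_sub.
have [_ ka _] := xa; have [_ kb _] := yb.
apply: linked_eqf (linked_sub xa' yb') _ _.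
  exact/afam_atrans/afam_add/afam_opp.
move=> c p q pq; rewrite atrans_add // /fadd; congr (_ + _).
by rewrite atrans_opp.
Qed.

Lemma kerrel_zero m : kerrel th (m := m) 0 0.
Proof.
exists (@fzero A), (@fzero A), (@fzero A'); split=> //; first exact: linked_zero.
apply: linked_eqf (linked_zero A' _) _ _; first exact/afam_atrans.
by move=> c [|p] [|q] // _; rewrite /= raddf0.
Qed.
End OneSided.

Lemma kerrel_sym (A A' : mcx) (th : forall c p, {additive A c p.+1 0 -> A' c p.+1 0})
    (th' : forall c p, {additive A' c p.+1 0 -> A c p.+1 0}) m
    (t : A cK 0 m.+2) (t' : A' cK 0 m.+2) :
  (forall c p, cancel (th c p) (th' c p)) -> kerrel th t t' -> kerrel th' t' t.
Proof.
move=> thK [x [a [x' [xa xa' xt xt']]]].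
exists x', (atrans th a), x; split=> //; have [_ ka _] := xa.
apply: linked_eqf xa _ _; first exact/afam_atrans/afam_atrans.
move=> c [|p] [|q] // pq /=; try exact: ka.2 _ (or_introl _).
by rewrite thK.
Qed.

Lemma iso_of_multicomplex_iso (A A' : mcx)
    (th : forall c p, {additive A c p.+1 0 -> A' c p.+1 0})
    (th' : forall c p, {additive A' c p.+1 0 -> A c p.+1 0}) m (H H' : groupType) :
  (forall c p, cancel (th c p) (th' c p)) ->
  (forall c p, cancel (th' c p) (th c p)) ->
  (forall c p x, th c p (dp x) = dp (th c p.+1 x)) ->
  (forall e p x, th (tgt e) p (ce e x) = ce e (th (src e) p x)) ->
  presents H (@kcycle A m) (@kbound A m) ->
  presents H' (@kcycle A' m) (@kbound A' m) -> group_iso H H'.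
Proof.
move=> thK thK' th_dp th_ce pH pH'.
have th_dp' c p x : th' c p (dp x) = dp (th' c p.+1 x).
  by apply: (can_inj (thK c p)); rewrite thK' th_dp thK'.
have th_ce' e p x : th' (tgt e) p (ce e x) = ce e (th' (src e) p x).
  by apply: (can_inj (thK _ p)); rewrite thK' th_ce thK'.
apply: (iso_of_relation (r := @kerrel A A' th m) pH pH').
- exact: kbound_zsub.
- exact: kbound_zsub.
- exact: kerrel_zero.
- by move=> *; exact: kerrel_sub.
- exact: kerrel_total.
- move=> t' /(kerrel_total th_dp' th_ce')[t tc tt'].
  by exists t => //; exact: kerrel_sym tt'.
- exact: kerrel_bound.
by move=> t t' /(kerrel_sym thK); exact: kerrel_bound.
Qed.
End Comparison.

(** * Contractions of resolutions *)

Lemma ord0_inord n : ord0 = inord 0 :> 'I_n.+1.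
Proof. by apply: val_inj; rewrite /= inordK. Qed.

Section Filling.
Variable K : sgroup.

(** Moore's argument that simplicial groups are Kan, for the horn without face 0. Faces are
    corrected from the last one down; the factor that corrects face j is degenerate, and the
    compatibility of [y] makes its higher faces trivial. *)
Lemma horn_filler n (y : nat -> K n.+1) :
  (forall i j, i < j <= n.+2 ->
    face (inord i) (y j) = face (inord j.-1) (y i)) ->
  exists z : K n.+2, forall i, 0 < i <= n.+2 -> face (inord i) z = y i.
Proof.
move=> yy.
suff /(_ n.+2 (leqnn _))[z zE] : forall k, k <= n.+2 ->
    exists z : K n.+2, forall i, n.+2 - k < i <= n.+2 -> face (inord i) z = y i.
  by exists z => i; rewrite -{1}(subnn n.+2); exact: zE.
elim=> [|k IH] kn.
  by exists 1 => i; rewrite subn0 ltnNge andNb.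
have [z zE] := IH (ltnW kn); pose j := n.+2 - k.
have [j' jE] : exists j', j = j'.+1 by exists j.-1; rewrite prednK // subn_gt0.
have jn : j <= n.+2 by rewrite leq_subr.
exists (z * degen (inord j') ((face (inord j) z)^-1 * y j)) => i.
rewrite subnS -/j jE /= => /andP[]; rewrite leq_eqVlt => /orP[/eqP <- _|ji ni].
  rewrite gmulfM face_degen_id -?jE //; last by right.
    by rewrite mulVKg.
  by rewrite -ltnS -jE.
rewrite gmulfM face_degen_gt ?ji // gmulfM gmulfV.
rewrite -jE in ji *.
rewrite -face_face ?ji // !zE ?ji // yy ?ji // mulVg gmulf1 mulg1.
by [].
Qed.

(** The error of the horn filler at face 0 is a cycle, hence face 0 of some [w] whose other faces
    are trivial; multiplying by [w] repairs face 0 alone. *)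
Lemma sphere_filler n (y : nat -> K n.+1) : (forall a : hgroup n.+1 K, a = 1) ->
  (forall i j, i < j <= n.+2 ->
    face (inord i) (y j) = face (inord j.-1) (y i)) ->
  exists z : K n.+2, forall i, i <= n.+2 -> face (inord i) z = y i.
Proof.
move=> acyc yy; have [z zE] := horn_filler yy.
have cyc : y 0 / face (inord 0) z \in scycles K n.+1.
  apply/scyclesSP => i; rewrite gmulfF -[i]inord_val.
  rewrite -(@face_face _ _ 0 i.+1) ?ltn_ord // zE ?ltn_ord //.
  by rewrite (yy 0 i.+1) ?ltn_ord // mulgV.
have := acyc (quo_pi _ (Subgrp cyc)).
move=> /(quo_eqP _ _ 1).1; rewrite divg1 => /sboundariesP[w w1 /= w0].
exists (w * z) => i; rewrite gmulfM; case: i => [_|i ni].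
  by rewrite -ord0_inord -w0 ord0_inord mulgVK.
rewrite w1 ?mul1g ?zE //.
by apply/eqP => /(congr1 val); rewrite /= inordK.
Qed.
End Filling.

Section Resolution.
Variables (G : groupType) (K : resolution G).

Definition raug (x : K 0) : G :=
  res_iso K (quo_pi (sboundaries K 0) (@Subgrp _ (scycles K 0) x isT)).

Fact raug_monoid_morphism : monoid.monoid_morphism raug.
Proof.
split=> [|x y]; rewrite /raug.
  by rewrite (_ : Subgrp _ = 1) ?gmulf1 //; apply: val_inj.
by rewrite -!gmulfM; congr (res_iso _ (quo_pi _ _)); apply: val_inj.
Qed.

HB.instance Definition _ :=
  isUMagmaMorphism.Build (K 0) G raug raug_monoid_morphism.

Lemma raug_surj : surjective raug.
Proof.
have [g gK Kg] := res_isoP K.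
move=> a; elim/quotW: (g a) (Kg a) => -[x Kx] <-; exists x; congr (res_iso _ _).
by rewrite /quo_pi; congr \pi; apply: val_inj.
Qed.

Lemma raug_eq1 x : raug x = 1 -> exists2 y : K 1%N,
  forall i : 'I_2, i != ord0 -> face i y = 1 & x = face ord0 y.
Proof.
move=> x1; pose x' : subgrp (scycles K 0) := @Subgrp _ (scycles K 0) x isT.
suff /sboundariesP : x' \in sboundaries K 0 by [].
rewrite -[X in X \in _]divg1; apply: (quo_eqP _ _ _).1.
by apply: (bij_inj (res_isoP K)); rewrite [LHS]x1 gmulf1.
Qed.

Lemma raug_face (y : K 1%N) : raug (face (inord 0) y) = raug (face (inord 1%N) y).
Proof.
congr (res_iso _ _); apply/quo_eqP/sboundariesP.
exists (y / degen (inord 0) (face (inord 1%N) y)) => [i i0|].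
  have -> : i = inord 1%N.
    by apply: val_inj; rewrite /= inordK //; case: i i0 => [[|[|]]].
  by rewrite gmulfF face_degen_id //; [rewrite mulgV|right].
by rewrite ord0_inord gmulfF face_degen_id //; left.
Qed.

Definition robj q : groupType := if q is q'.+1 then K q' else G.

Definition rface q (i : nat) : {ghom robj q.+1 -> robj q} :=
  match q return {ghom robj q.+1 -> robj q} with
  | q'.+1 => @face K q' (inord i)
  | 0 => raug
  end.

Lemma rface_rface q i j x : i < j <= q.+1 ->
  rface q i (rface q.+1 j x) = rface q j.-1 (rface q.+1 i x).
Proof.
case: q x => [|q] x; last exact: face_face.
by case: i j => [|i] [|[|j]] // /andP[] //; rewrite /= raug_face.
Qed.

(** The second clause is the matching condition for the faces x, h (d_0 x), ..., h (d_q x)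
    prescribed for the next contraction at x. *)
Definition contracting q (h : robj q -> robj q.+1) :=
  (forall x, rface q 0 (h x) = x) /\
  (forall i j x, i < j <= q ->
    rface q i.+1 (h (rface q j x)) = rface q j (h (rface q i x))).

Definition extends_contraction q (h : robj q -> robj q.+1)
    (h' : robj q.+1 -> robj q.+2) :=
  (forall x, rface q.+1 0 (h' x) = x) /\
  (forall i x, i <= q -> rface q.+1 i.+1 (h' x) = h (rface q i x)).

Lemma contracting_extends q h h' :
  @extends_contraction q h h' -> contracting h'.
Proof.
case=> h0 hS; split=> // i [//|j] x ij.
have iq : i <= q by rewrite -ltnS; case/andP: ij => /leq_trans; apply.
rewrite hS // hS; last by case/andP: ij.
by rewrite rface_rface.
Qed.

Lemma contraction_step q h : @contracting q h ->
  exists h', @extends_contraction q h h'.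
Proof.
case=> h0 hh.
suff hx x : exists z : robj q.+2, rface q.+1 0 z = x /\
    forall i, i <= q -> rface q.+1 i.+1 z = h (rface q i x).
  by have [h' h'E] := choice hx; exists h'; split=> [x|i x]; apply h'E.
pose y i : robj q.+1 := if i is i'.+1 then h (rface q i' x) else x.
suff [z zE] : exists z : robj q.+2, forall i, i <= q.+1 -> rface q.+1 i z = y i.
  by exists z; split=> [|i iq]; rewrite zE.
move: @y; case: q h h0 hh x => [|q] h h0 hh x y; last first.
  apply: sphere_filler; first exact: res_acyclic.
  case=> [|i] [|j] // ij; first exact: h0.
  exact: hh.
(* For q = 0 the prescribed faces are two vertices with the same image in [G]; they are joined by an
   edge since their quotient is in the kernel of the augmentation. *)
have [|w w1 w0] := @raug_eq1 (x / y 1%N).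
  have := h0 (raug x); rewrite /= => e.
  by rewrite gmulfF /= e mulgV.
exists (w * degen (inord 0) (y 1%N)) => -[|[|]] //= _; rewrite gmulfM.
  by rewrite face_degen_id //; [rewrite -ord0_inord -w0 mulgVK|left].
rewrite w1 ?mul1g ?face_degen_id //; first by right.
by apply/eqP => /(congr1 val); rewrite /= inordK.
Qed.

Lemma contraction0 : exists h, @contracting 0 h.
Proof.
have [h hK] := choice raug_surj.
by exists h; split=> // i [].
Qed.

Fixpoint rcontraction q : {h | @contracting q h} :=
  match q return {h | @contracting q h} with
  | 0 => cid contraction0
  | q'.+1 =>
    let s := cid (contraction_step (svalP (rcontraction q'))) in
    exist _ (sval s) (contracting_extends (svalP s))
  end.

Definition rctr q : robj q -> robj q.+1 := sval (rcontraction q).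

Lemma rface0_rctr q x : rface q 0 (rctr x) = x.
Proof. exact: (svalP (rcontraction q)).1. Qed.

Lemma rfaceS_rctr q i x : i <= q ->
  rface q.+1 i.+1 (rctr x) = rctr (rface q i x).
Proof.
exact: (svalP (cid (contraction_step (svalP (rcontraction q))))).2.
Qed.

(** Each basis element is sent to its generator; the uniqueness part of freeness identifies the
    composite with the identity. *)
Lemma rsec_ex q : exists s : {ghom K q -> fgroup (K q)}, cancel s (feps _).
Proof.
have [B [Bf _]] := res_free K.
have [s sB _] := Bf q _ (@fgen (K q)); exists s => x.
have [f fB funiq] := Bf q _ (id : K q -> K q).
rewrite -[RHS]/((idfun : {ghom K q -> K q}) x) (funiq idfun) //.
rewrite -(funiq (feps (K q) \o s)) // => b Bb /=.
by rewrite sB // feps_gen.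
Qed.
End Resolution.

(** * Squares of augmented presimplicial groups *)

(* Level 0 is the augmentation and level q + 1 is the q-th term of the
   resolution. *)
Record asquare := ASquare {
  aobj :> corner -> nat -> groupType;
  aface : forall c q, nat -> {ghom aobj c q.+1 -> aobj c q};
  amap : forall e q, {ghom aobj (src e) q -> aobj (tgt e) q};
  aface_aface : forall c q (i j : nat) x, i < j <= q.+1 ->
    aface c q i (aface c q.+1 j x) = aface c q j.-1 (aface c q.+1 i x);
  amap_face : forall e q i x, i <= q ->
    amap e q (aface _ q i x) = aface _ q i (amap e q.+1 x);
  amap_comm : forall q x, amap eg q (amap eb q x) = amap ed q (amap ea q x);
  actr : forall c q, aobj c q -> aobj c q.+1;
  aface0_actr : forall c q x, aface c q 0 (actr x) = x;
  afaceS_actr : forall c q (i : nat) x, i <= q ->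
    aface c q.+1 i.+1 (actr x) = actr (aface c q i x);
  asec : forall c q, {ghom aobj c q.+1 -> fgroup (aobj c q.+1)};
  asecK : forall c q, cancel (asec c q) (feps _);
  amap_surj : forall q (y : abz (aobj cS q.+1)),
    exists x, abz_map (amap eg q.+1) x = y;
  amap_pullback : forall q (y : abz (aobj cL q.+1)) (z : abz (aobj cR q.+1)),
    abz_map (amap eg q.+1) z = abz_map (amap ed q.+1) y ->
    exists2 x, abz_map (amap ea q.+1) x = y & abz_map (amap eb q.+1) x = z
}.

(** * The multicomplex of a square *)

Section MultiComplexOfSquare.
Variable Y : asquare.

Definition tobj c p q : zmodType := abz (ftower p (Y c q)).

Definition tdp c p q : {additive tobj c p.+1 q -> tobj c p q} :=
  @bd (fun p => tobj c p q) (fun p i => abz_map (tface p i (Y c q))) p.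

Definition tdq c p q : {additive tobj c p q.+1 -> tobj c p q} :=
  @bd (tobj c p) (fun q i => abz_map (tmap p (aface Y c q i))) q.

Definition tce e p q : {additive tobj (src e) p q -> tobj (tgt e) p q} :=
  abz_map (tmap p (amap Y e q)).

(** The contraction [actr] is a function, so it acts only once a free group functor has been
    applied; the value at p = 0 is a dummy. *)
Definition thq c p q : tobj c p q -> tobj c p q.+1 :=
  match p return tobj c p q -> tobj c p q.+1 with
  | p'.+1 => abz_map (fmap (tfun p' (@actr Y c q)))
  | 0 => fun _ => 0%R
  end.

(** The sign cancels the one produced by a contraction at the last face. *)
Definition thp c p q (x : tobj c p q.+1) : tobj c p.+1 q.+1 :=
  sg (odd p) (abz_map (tsec (asec Y c q) p) x).

Fact tdp_tdp c p q x : tdp c p q (tdp c p.+1 q x) = 0%R.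
Proof.
apply: (@bd_bd (fun p => tobj c p q)) => i j ij.
by apply: abz_map_sq => s; exact: tface_tface.
Qed.

Fact tdq_tdq c p q x : tdq c p q (tdq c p q.+1 x) = 0%R.
Proof.
apply: (@bd_bd (tobj c p)) => i j ij.
by apply: abz_map_sq => s; apply: tmap_sq => t; exact: aface_aface.
Qed.

Fact tdp_nat p (G H : groupType) (f : {ghom G -> H}) x :
  abz_map (tmap p f)
    (@bd (fun p => abz (ftower p G)) (fun p i => abz_map (tface p i G)) p x) =
  @bd (fun p => abz (ftower p H)) (fun p i => abz_map (tface p i H)) p
    (abz_map (tmap p.+1 f) x).
Proof.
apply: (@bd_nat (fun p => abz (ftower p G)) (fun p => abz (ftower p H)) _ _ p
  (abz_map (tmap p.+1 f)) (abz_map (tmap p f))) => i _.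
by apply: abz_map_sq => s; exact/esym/tface_nat.
Qed.

Fact tdp_tdq c p q x : tdp c p q (tdq c p.+1 q x) = tdq c p q (tdp c p q.+1 x).
Proof.
rewrite /tdq /bd raddf_sum; apply: eq_bigr => i _.
by rewrite (raddf_sg (tdp c p q)); congr sg; exact/esym/tdp_nat.
Qed.

Fact tce_tdp e p q x : tce e p q (tdp _ p q x) = tdp _ p q (tce e p.+1 q x).
Proof. exact: tdp_nat. Qed.

Fact tce_tdq e p q x : tce e p q (tdq _ p q x) = tdq _ p q (tce e p q.+1 x).
Proof.
apply: (@bd_nat (tobj (src e) p) (tobj (tgt e) p) _ _ q
  (tce e p q.+1) (tce e p q)) => i iq.
by apply: abz_map_sq => s; apply: tmap_sq => t; exact: amap_face.
Qed.

Fact tce_comm p q x : tce eg p q (tce eb p q x) = tce ed p q (tce ea p q x).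
Proof. by apply: abz_map_sq => s; apply: tmap_sq => t; exact: amap_comm. Qed.

Fact aface0_thq c p q x :
  abz_map (tmap p.+1 (aface Y c q 0)) (@thq c p.+1 q x) = x.
Proof.
apply: abz_map_can => s.
rewrite -[LHS]/(tmap p.+1 (aface Y c q 0) (tfun p.+1 (@actr Y c q) s)) tmapE.
exact/tfun_can/aface0_actr.
Qed.

Fact tdq_thq0 c p x : tdq c p.+1 0 (@thq c p.+1 0 x) = x.
Proof. exact/(bd_contraction0 (h := @thq c p.+1 0))/aface0_thq. Qed.

Fact tdq_thq c p q x : tdq c p.+1 q x = 0%R ->
  tdq c p.+1 q.+1 (@thq c p.+1 q.+1 x) = x.
Proof.
move=> dx.
have := @bd_contraction (tobj c p.+1)
  (fun q i => abz_map (tmap p.+1 (aface Y c q i))) q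
  (abz_map (fmap (tfun p (@actr Y c q.+1))))
  (abz_map (fmap (tfun p (@actr Y c q)))) x (aface0_thq x).
rewrite -[bd _ x]/(tdq c p.+1 q x) dx raddf0 subr0; apply => i iq.
apply: abz_map_sq => s.
rewrite -[LHS]/(tmap p.+1 (aface Y c q.+1 i.+1) (tfun p.+1 (@actr Y c q.+1) s)).
rewrite -[RHS]/(tfun p.+1 (@actr Y c q) (tmap p.+1 (aface Y c q i) s)) !tmapE.
by apply: tfun_sq => t; exact: afaceS_actr.
Qed.

Fact tdp_thp0 c q x : tdp c 0 q.+1 (@thp c 0 q x) = x.
Proof.
apply: (bd_contraction0 (h := @thp c 0 q) (C := fun p => tobj c p q.+1)).
exact/abz_map_can/asecK.
Qed.

Fact tdp_thp c p q x : tdp c p q.+1 x = 0%R ->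
  tdp c p.+1 q.+1 (@thp c p.+1 q x) = x.
Proof.
move=> dx; rewrite /thp (raddf_sg (tdp c p.+1 q.+1)).
have -> : tdp c p.+1 q.+1 (abz_map (tsec (asec Y c q) p.+1) x) = sg (odd p.+1) x.
  rewrite -[RHS]add0r -(raddf0 (abz_map (tsec (asec Y c q) p))) -dx.
  apply: (@bd_back_contraction (fun p => tobj c p q.+1)
    (fun p i => abz_map (tface p i (Y c q.+1))) p).
    by apply: abz_map_can; exact/tsecK/asecK.
  move=> i ip; apply: abz_map_sq => s; exact: tface_tsec.
by rewrite sgK.
Qed.

Definition amcx : mcx := @Mcx tobj tdp tdq tce tdp_tdp tdq_tdq tdp_tdq tce_tdp
  tce_tdq tce_comm (fun c p q => @thq c p.+1 q) tdq_thq0 tdq_thq thp tdp_thp0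
  tdp_thp (@amap_surj Y) (@amap_pullback Y).
End MultiComplexOfSquare.

Section DegreeOne.
Local Open Scope ring_scope.
Variable Y : asquare.

Definition acycle (t : abz (Y cK 2%N)) :=
  [/\ abz_map (amap Y ea 2) t = 0, abz_map (amap Y eb 2) t = 0
    & abz_map (aface Y cK 1 0) t = abz_map (aface Y cK 1 1) t].

Definition abound (t : abz (Y cK 2%N)) := exists u : abz (Y cK 3%N),
  [/\ abz_map (amap Y ea 3) u = 0, abz_map (amap Y eb 3) u = 0
    & t = abz_map (aface Y cK 2 0) u +
          (abz_map (aface Y cK 2 2) u - abz_map (aface Y cK 2 1) u)].

Lemma kcycle_amcx t : @kcycle (amcx Y) 0 t <-> acycle t.
Proof.
have dE : dq (m := amcx Y) (c := cK) (p := 0) (q := 1) t =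
    abz_map (aface Y cK 1 0) t - abz_map (aface Y cK 1 1) t.
  by rewrite [LHS]big_ord_recl big_ord1.
split=> [[ta tb]|[ta tb dt]]; rewrite ?dE; last first.
  by split; rewrite ?dE ?dt ?subrr.
by move=> /subr0_eq.
Qed.

Lemma kbound_amcx t : @kbound (amcx Y) 0 t <-> abound t.
Proof.
have dE u : dq (m := amcx Y) (c := cK) (p := 0) (q := 2) u =
    abz_map (aface Y cK 2 0) u +
    (abz_map (aface Y cK 2 2) u - abz_map (aface Y cK 2 1) u).
  by rewrite [LHS]big_ord_recl big_ord_recl big_ord1 /= [X in _ + X]addrC.
by split=> [] [u [ua ub du]]; exists u; split=> //; rewrite -?dE // dE.
Qed.

Lemma abound_zsub : zsub abound.
Proof.
have [B0 Bs] := kbound_zsub (amcx Y) 0.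
split; first exact: (kbound_amcx _).1 B0.
by move=> u v /kbound_amcx bu /kbound_amcx bv; apply/kbound_amcx/Bs.
Qed.
End DegreeOne.

Lemma iso_of_augmentation_iso (Y Y' : asquare)
    (f : forall c, {ghom Y c 0 -> Y' c 0}) (g : forall c, {ghom Y' c 0 -> Y c 0})
    (H H' : groupType) :
  (forall c, cancel (f c) (g c)) -> (forall c, cancel (g c) (f c)) ->
  (forall e x, f (tgt e) (amap Y e 0 x) = amap Y' e 0 (f (src e) x)) ->
  presents H (@acycle Y) (@abound Y) -> presents H' (@acycle Y') (@abound Y') ->
  group_iso H H'.
Proof.
move=> fK gK fe pH pH'.
apply: (@iso_of_multicomplex_iso (amcx Y) (amcx Y')
  (fun c p => abz_map (tmap p.+1 (f c))) (fun c p => abz_map (tmap p.+1 (g c))) 0).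
- by move=> c p; apply: abz_map_can; apply: tmap_can.
- by move=> c p; apply: abz_map_can; apply: tmap_can.
- by move=> c p x; exact: (tdp_nat (p := p.+1)).
- by move=> e p x; apply: abz_map_sq => s; apply: (tmap_sq (p := p.+1)) => t; exact: fe.
- exact: presents_ext pH (@kcycle_amcx Y) (@kbound_amcx Y).
exact: presents_ext pH' (@kcycle_amcx Y') (@kbound_amcx Y').
Qed.

(** * Moore homology and unnormalized chains in degree 1 *)

Section LowDegree.
Variable T : sgroup.

Lemma cycle1_normalize (t : T 1%N) : face (inord 0) t = face (inord 1%N) t ->
  t / degen (inord 0) (face (inord 0) t) \in scycles T 1.
Proof.
move=> dt; apply/scyclesSP => i; rewrite gmulfF -[i]inord_val.
case: i => [[|[|]]] //= _; rewrite face_degen_id //; first by rewrite mulgV.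
- by left.
- by rewrite dt mulgV.
by right.
Qed.

(** The degenerate factor removed in [cycle1_normalize] does not change the homology class. *)
Lemma degen_boundary (x : T 0) : exists u : T 2,
  degen (inord 0) x =
  face (inord 0) u * (face (inord 2) u / face (inord 1%N) u).
Proof.
exists (degen (inord 0) (degen (inord 0) x)).
rewrite (@face_degen_id _ _ 0) //; last by left.
rewrite (@face_degen_id _ _ 1) //; last by right.
rewrite (@face_degen_gt _ _ 2 0) //= (@face_degen_id _ _ 1) //; last by right.
by rewrite mulgV mulg1.
Qed.

(** Normalization of a bounding 2-simplex [u]: dividing by degenerate elements makes face 2, then
    face 1, trivial, while face 0 takes the value of the whole alternating product. *)
Lemma boundary1P (x : subgrp (scycles T 1)) : x \in sboundaries T 1 <->
  exists u : T 2, sgval x =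
    face (inord 0) u * (face (inord 2) u / face (inord 1%N) u).
Proof.
split=> [/sboundariesP[u u1 xu]|[u xu]].
  exists u; rewrite xu (u1 (inord 1%N)) ?(u1 (inord 2)) ?divgg ?mulg1 ?ord0_inord //;
    by apply/eqP => /(congr1 val); rewrite /= !inordK.
pose y1 := u / degen (inord 1%N) (face (inord 2) u).
pose y := y1 / degen (inord 0) (face (inord 1%N) y1).
have d2y1 : face (inord 2) y1 = 1.
  by rewrite gmulfF face_degen_id ?mulgV //; right.
have d1y1 : face (inord 1%N) y1 = face (inord 1%N) u / face (inord 2) u.
  by rewrite gmulfF face_degen_id //; left.
(* In d_1 x = 1 the factors d_1 d_2 u and d_1 d_1 u cancel, leaving d_1 d_0 u = d_0 d_2 u. *)
have d02u : face (inord 0) (face (inord 2) u) = 1.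
  have /scyclesSP /(_ (inord 1%N)) := sgvalP x.
  rewrite xu !gmulfM gmulfV (@face_face _ _ 1 2) // mulgV mulg1 => <-.
  by rewrite (@face_face _ _ 0 2).
have d0y1 : face (inord 0) y1 = face (inord 0) u.
  by rewrite gmulfF (@face_degen_lt _ _ 0 1) //= d02u gmulf1 divg1.
apply/sboundariesP; exists y => [i i0|]; last first.
  by rewrite ord0_inord gmulfF d0y1 face_degen_id ?d1y1 ?invgF //; left.
rewrite -[i]inord_val gmulfF; case: i i0 => [[|[|[|]]]] //= _ _.
  by rewrite face_degen_id ?mulgV //; right.
rewrite d2y1 (@face_degen_gt _ _ 2 0) //= (_ : face (inord 1%N) _ = 1).
  by rewrite gmulf1 divg1.
by rewrite -(@face_face _ _ 1 2) // d2y1 gmulf1.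
Qed.
End LowDegree.

(** * Squares of resolutions *)

Lemma sker_faceE (K L : sgroup) (f : smor K L) n i (t : sker f n.+1) :
  sgval (face i t) = face i (sgval t).
Proof. by []. Qed.

Section EmbeddedSimplicialGroup.
Variables (T K : sgroup) (v : forall n, T n -> abz (K n)).
Variable P : forall n, abz (K n) -> Prop.
Hypothesis v_inj : forall n, injective (@v n).
Hypothesis vM : forall n (s t : T n), v (s * t) = (v s + v t)%R.
Hypothesis vV : forall n (s : T n), v s^-1 = (- v s)%R.
Hypothesis v_face : forall n i (t : T n.+1), v (face i t) = abz_map (@face K n i) (v t).
Hypothesis v_ker : forall n (t : T n), P (v t).
Hypothesis v_ex : forall n (u : abz (K n)), P u -> exists t : T n, v t = u.

Definition lcycle (t : abz (K 1%N)) :=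
  P t /\ abz_map (face (inord 0)) t = abz_map (@face K 0 (inord 1%N)) t.

Definition lbound (t : abz (K 1%N)) := exists u : abz (K 2%N),
  P u /\ t = (abz_map (face (inord 0)) u +
          (abz_map (face (inord 2)) u - abz_map (@face K 1 (inord 1%N)) u))%R.

Let lbound_v (x : T 1%N) (u : T 2%N) :
  x = face (inord 0) u * (face (inord 2) u / face (inord 1%N) u) ->
  lbound (v x).
Proof.
move=> ->; exists (v u); split; first exact: v_ker.
by rewrite !vM vV !v_face.
Qed.

Let boundP (x : subgrp (scycles T 1)) :
  x \in sboundaries T 1 <-> lbound (v (sgval x)).
Proof.
split=> [/boundary1P[u xu]|[u [uP du]]]; first exact: lbound_v xu.
apply/boundary1P; have [u' u'E] := v_ex uP; exists u'; apply: v_inj.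
by rewrite du -u'E !vM vV !v_face.
Qed.

(** [T] will be the total kernel, whose elements lie in two nested subtypes; the embedding [v] with
    image [P] hides them. An unnormalized cycle is a Moore cycle times a degenerate element, and the
    latter bounds. *)
Lemma presents_linear_kernel : zsub lbound -> presents (hgroup 1 T) lcycle lbound.
Proof.
move=> sB; exists (fun a => v (sgval (repr a))); split.
- move=> a; split; first exact: v_ker.
  have /scyclesSP cyc := sgvalP (repr a).
  by rewrite -[LHS]v_face -[RHS]v_face !cyc.
- move=> a b; rewrite -vM -vV -vM -sgvalM -sgvalV -sgvalM.
  by apply/boundP/quo_eqP; rewrite reprK.
- move=> a b; rewrite -vV -vM -sgvalV -sgvalM => /boundP/quo_eqP.
  by rewrite !reprK.
move=> t [tP dt]; have [s sE] := v_ex tP.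
have ds : face (inord 0) s = face (inord 1%N) s.
  by apply: v_inj; rewrite !v_face sE.
have cs := cycle1_normalize ds; exists (quo_pi _ (Subgrp cs)).
have /boundP := quo_repr (sboundaries T 1) (Subgrp cs).
rewrite sgvalM sgvalV vM vV => bs; rewrite -sE.
have -> : (v s - v (sgval (repr (quo_pi (sboundaries T 1) (Subgrp cs)))) =
  v (degen (inord 0) (face (inord 0) s)) -
  (v (sgval (repr (quo_pi (sboundaries T 1) (Subgrp cs)))) -
   v (sgval (Subgrp cs))))%R.
  rewrite /= [in RHS]vM vV opprB addrA (addrC _ (v s - _)%R) subrK.
  by [].
apply: sB.2 => //; have [u uE] := degen_boundary (face (inord 0) s).
exact: lbound_v uE.
Qed.
End EmbeddedSimplicialGroup.

Section TotalKernel.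
Variables (K L R S : sgroup).
Variables (al : smor K L) (be : smor K R) (ga : smor R S) (de : smor L S).
Variable comm : scommutes al ga be de.

Local Notation tker := (sker (sker_map (sab_commutes comm))).

Definition vtk n (t : tker n) : abz (K n) := sgval (sgval t).

Fact vtk_inj n : injective (@vtk n).
Proof. by move=> s t /val_inj/val_inj. Qed.

Fact vtkM n (s t : tker n) : vtk (s * t) = (vtk s + vtk t)%R.
Proof. by rewrite /vtk !sgvalM. Qed.

Fact vtkV n (s : tker n) : vtk s^-1 = (- vtk s)%R.
Proof. by rewrite /vtk !sgvalV. Qed.

Fact vtk_ker n (t : tker n) :
  abz_map (al n) (vtk t) = 0%R /\ abz_map (be n) (vtk t) = 0%R.
Proof.
split; first exact/eqP/(sgvalP (sgval t)).
by have /kernelP/(congr1 (@sgval _ _)) := sgvalP t; rewrite sgval1.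
Qed.

Fact vtk_ex n (u : abz (K n)) : abz_map (al n) u = 0%R ->
  abz_map (be n) u = 0%R -> exists t, @vtk n t = u.
Proof.
move=> ua ub; have ka : u \in kernel (ab_map (al n)) by exact/eqP.
have kb : (Subgrp ka) \in kernel (sker_map (sab_commutes comm) n).
  by apply/eqP/val_inj; exact: ub.
by exists (Subgrp kb).
Qed.

Fact vtk_face n i (t : tker n.+1) :
  vtk (face i t) = abz_map (@face (K) n i) (vtk t).
Proof. by rewrite /vtk !sker_faceE. Qed.

End TotalKernel.

Section SquareOfResolutions.
Variables (G : groupType) (M N : normalClosed G) (X : res_square M N).

Definition cgrp c : groupType := match c with
  | cK => G | cL => quo N | cR => quo M | cS => quo (nprod M N) end.

Definition cres c : resolution (cgrp c) :=
  match c return resolution (cgrp c) with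
  | cK => rsK X | cL => rsL X | cR => rsR X | cS => rsS X end.

Definition cproj e : {ghom cgrp (src e) -> cgrp (tgt e)} :=
  match e return {ghom cgrp (src e) -> cgrp (tgt e)} with
  | ea => quo_pi N
  | eb => quo_pi M
  | eg => quo_proj (@sub_nprodl G M N)
  | ed => quo_proj (@sub_nprodr G M N)
  end.

Definition cmor e : smor (cres (src e)) (cres (tgt e)) :=
  match e return smor (cres (src e)) (cres (tgt e)) with
  | ea => rs_alpha X | eb => rs_beta X | eg => rs_gamma X | ed => rs_delta X
  end.

Lemma raug_cmor e x : raug (cmor e 0 x) = cproj e (raug x).
Proof.
have E (G1 G2 : groupType) (K1 : resolution G1) (K2 : resolution G2)
    (f : smor K1 K2) (p : {ghom G1 -> G2}) :
    (forall a, res_iso K2 (hgroup_map 0 f a) = p (res_iso K1 a)) ->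
    forall y, raug (f 0 y) = p (raug y).
  move=> fp y; rewrite /raug -fp hgroup_mapE.
  by congr (res_iso _ (quo_pi _ _)); exact: val_inj.
by case: e x => x; apply: E;
  [exact: rs_alpha_pi0|exact: rs_beta_pi0|exact: rs_gamma_pi0|exact: rs_delta_pi0].
Qed.

Definition rmap e q : {ghom robj (cres (src e)) q -> robj (cres (tgt e)) q} :=
  match q return {ghom robj (cres (src e)) q -> robj (cres (tgt e)) q} with
  | q'.+1 => cmor e q'
  | 0 => cproj e
  end.

Fact rmap_rface e q i x : i <= q ->
  rmap e q (rface (cres (src e)) q i x) = rface (cres (tgt e)) q i (rmap e q.+1 x).
Proof.
by case: q x => [|q] x _; [rewrite /= raug_cmor|exact: smap_face].
Qed.

Fact rmap_comm q x : rmap eg q (rmap eb q x) = rmap ed q (rmap ea q x).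
Proof.
by case: q x => [|q] x; [rewrite /= !quo_projE|exact: (rs_comm X)].
Qed.

Fact rmap_surj q (y : abz (robj (cres cS) q.+1)) :
  exists x, abz_map (rmap eg q.+1) x = y.
Proof. exact: (@rs_gamma_surj _ _ _ X q y). Qed.

(** Lift [y] to [x]; the error z - beta x lies in the kernel of gamma, so it lifts to the kernel of
    alpha. *)
Fact rmap_pullback q (y : abz (robj (cres cL) q.+1)) (z : abz (robj (cres cR) q.+1)) :
  abz_map (rmap eg q.+1) z = abz_map (rmap ed q.+1) y ->
  exists2 x, abz_map (rmap ea q.+1) x = y & abz_map (rmap eb q.+1) x = z.
Proof.
move=> zy; have [x xy] := @rs_alpha_surj _ _ _ X q y.
have k0 : z / (abz_map (rmap eb q.+1) x : ab _) \in kernel (ab_map (rs_gamma X q)).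
  apply/eqP; rewrite gmulfF; apply/eqP; rewrite divg_eq1; apply/eqP.
  apply: (etrans zy); rewrite -xy.
  exact/esym/(sab_commutes (rs_comm X)).
have [k kE] := @rs_ker_alpha_surj _ _ _ X q (Subgrp k0).
pose k' : abz (robj (cres cK) q.+1) := sgval k.
have ak : abz_map (rmap ea q.+1) k' = 0%R by exact/eqP/(sgvalP k).
have bk : abz_map (rmap eb q.+1) k' = (z - abz_map (rmap eb q.+1) x)%R.
  exact: (congr1 (@sgval _ _) kE).
exists (k' + x)%R; first by rewrite raddfD /= ak add0r.
by rewrite raddfD /= bk subrK.
Qed.

Definition rsec c q := projT1 (cid (rsec_ex (cres c) q)).
Definition rsecK c q : cancel (rsec c q) (feps _) := projT2 (cid (rsec_ex (cres c) q)).

Definition rsquare : asquare := @ASquare (fun c => robj (cres c)) _ rmap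
  (fun c => @rface_rface _ (cres c)) rmap_rface rmap_comm
  (fun c => @rctr _ (cres c)) (fun c => @rface0_rctr _ (cres c))
  (fun c => @rfaceS_rctr _ (cres c)) rsec rsecK rmap_surj rmap_pullback.

Lemma presents_schur : presents (schur_multiplier X)
  (@acycle rsquare) (@abound rsquare).
Proof.
pose P n (u : abz (rsK X n)) :=
  abz_map (rs_alpha X n) u = 0%R /\ abz_map (rs_beta X n) u = 0%R.
have tZ v : @acycle rsquare v <-> @lcycle (rsK X) P v.
  by split=> [[? ? ?]|[[? ?] ?]]; do ?split.
have tB v : @abound rsquare v <-> @lbound (rsK X) P v.
  by split=> [[u [? ? ?]]|[u [[? ?] ?]]]; exists u; do ?split.
apply: (presents_ext _ tZ tB).
apply: (presents_linear_kernel (v := @vtk _ _ _ _ _ _ _ _ (rs_comm X))).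
- exact: vtk_inj.
- exact: vtkM.
- exact: vtkV.
- exact: vtk_face.
- exact: vtk_ker.
- by move=> n u [ua ub]; exact: vtk_ex.
have [B0 Bs] := @abound_zsub rsquare.
split; first exact: (tB _).1 B0.
by move=> u v /tB bu /tB bv; apply/tB; exact: Bs.
Qed.
End SquareOfResolutions.

(** * Free products *)

Section TrivialMorphism.
Variables G H : groupType.

Definition gtriv (_ : G) : H := 1.

Fact gtriv_monoid_morphism : monoid.monoid_morphism gtriv.
Proof. by split=> // x y; rewrite /gtriv mulg1. Qed.

HB.instance Definition _ :=
  isUMagmaMorphism.Build G H gtriv gtriv_monoid_morphism.
End TrivialMorphism.

Lemma fp_ext (G H K : groupType) (f g : {ghom freeprod G H -> K}) :
  (forall x, f (fp_inl H x) = g (fp_inl H x)) ->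
  (forall y, f (fp_inr G y) = g (fp_inr G y)) -> f =1 g.
Proof.
move=> fgl fgr x.
rewrite (@fp_elim_uniq _ _ _ (g \o @fp_inl G H) (g \o @fp_inr G H) f) //.
by rewrite -(@fp_elim_uniq _ _ _ (g \o @fp_inl G H) (g \o @fp_inr G H) g).
Qed.

Definition fp_map (G H G' H' : groupType) (f : {ghom G -> G'}) (g : {ghom H -> H'}) :
    {ghom freeprod G H -> freeprod G' H'} :=
  fp_elim (@fp_inl G' H' \o f) (@fp_inr G' H' \o g).

Lemma fp_map_inl (G H G' H' : groupType) (f : {ghom G -> G'}) (g : {ghom H -> H'}) x :
  fp_map f g (fp_inl H x) = fp_inl H' (f x).
Proof. exact: (fp_elim_inl (@fp_inl G' H' \o f) (@fp_inr G' H' \o g)). Qed.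

Lemma fp_map_inr (G H G' H' : groupType) (f : {ghom G -> G'}) (g : {ghom H -> H'}) y :
  fp_map f g (fp_inr G y) = fp_inr G' (g y).
Proof. exact: (fp_elim_inr (@fp_inl G' H' \o f) (@fp_inr G' H' \o g)). Qed.

Lemma fp_map_sq (G H G1 H1 G2 H2 K L : groupType)
    (f : {ghom G -> G1}) (f' : {ghom G1 -> K})
    (k : {ghom G -> G2}) (k' : {ghom G2 -> K})
    (g : {ghom H -> H1}) (g' : {ghom H1 -> L})
    (l : {ghom H -> H2}) (l' : {ghom H2 -> L}) x :
  (forall s, f' (f s) = k' (k s)) -> (forall s, g' (g s) = l' (l s)) ->
  fp_map f' g' (fp_map f g x) = fp_map k' l' (fp_map k l x).
Proof.
move=> fk gl.
apply: (fp_ext (f := fp_map f' g' \o fp_map f g)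
               (g := fp_map k' l' \o fp_map k l)) x => s /=.
  by rewrite !fp_map_inl fk.
by rewrite !fp_map_inr gl.
Qed.

(* As a set, G * H is a retract of G x H x F(H x G) through
   (a, b, w) |-> a b w, where the generator (b, a) stands for [b, a]. The
   second set depends functorially on the mere sets G and H, so that set-level
   contractions of G and H induce one of G * H. *)
Definition fpset (S T : choiceType) : Type := (S * T * fgroup (T * S)%type)%type.

Definition fpset_map (S T S' T' : choiceType) (f : S -> S') (g : T -> T')
    (p : fpset S T) : fpset S' T' :=
  (f p.1.1, g p.1.2,
   fmap (fun ba : T * S => (g ba.1, f ba.2) : (T' * S')%type) p.2).

Section NormalForm.
Variables G H : groupType.

Definition fpset_gen (b : H) (a : G) : fgroup (H * G)%type :=
  fgen ((b, a) : (H * G)%type).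

(** Left multiplication by a letter, from y a b = a (y b) [y b, a] [b, a]^-1. The generators (1, a)
    and (b, 1) are kept although their commutators are trivial, because a contraction need not
    preserve 1; hence a retract and not a bijection. *)
Definition fpset_act (l : G + H) (p : fpset G H) : fpset G H :=
  match l with
  | inl x => (x * p.1.1, p.1.2, p.2)
  | inr y => (p.1.1, y * p.1.2,
      fpset_gen (y * p.1.2) p.1.1 * (fpset_gen p.1.2 p.1.1)^-1 * p.2)
  end.

Definition fpset_word (u : seq (G + H)) : fpset G H :=
  foldr fpset_act (1, 1, 1) u.

Definition fpset_of (x : freeprod G H) : fpset G H := fpset_word (repr x).

Lemma fpset_of_pi u : fpset_of (\pi_(freeprod G H) u) = fpset_word u.
Proof.
suff E v w : fp_eq v w -> fpset_word v = fpset_word w by exact/E/fp_eq_repr.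
elim=> {v w} [v w vw|//|v w _ ->//|v w z _ -> _ -> //].
case: vw => u' v' => [x y|x y||]; rewrite /fpset_word !foldr_cat /=; congr foldr;
  move: (foldr _ _ v') => [[a b] c] /=.
- by rewrite mulgA.
- by rewrite !mulgA mulgVK.
- by rewrite mul1g.
- by rewrite mul1g mulgV mul1g.
Qed.

Definition fpset_eval (p : fpset G H) : freeprod G H :=
  fp_inl H p.1.1 * fp_inr G p.1.2 *
  flift (fun ba : H * G => [~ fp_inr G ba.1, fp_inl H ba.2]) p.2.

Lemma fpset_eval_act l p :
  fpset_eval (fpset_act l p) = \pi_(freeprod G H) [:: l] * fpset_eval p.
Proof.
case: p => [[a b] w]; case: l => x; rewrite /fpset_eval /=.
  by rewrite gmulfM !mulgA.
rewrite /fpset_gen !gmulfM gmulfV /= !flift_gen /= invgR.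
rewrite -[\pi_(_) _]/(fp_inr G x) !gmulfM /=.
move: (flift _ _) (fp_inl H a) (fp_inr G b) (fp_inr G x) => w' a' b' x'.
by rewrite /commg /conjg invgM !mulgA !mulgK mulgV mul1g.
Qed.

Lemma fpset_evalK x : fpset_eval (fpset_of x) = x.
Proof.
elim/quotW: x => u; rewrite fpset_of_pi; elim: u => [|l u IH].
  by rewrite /fpset_eval /= !gmulf1 !mulg1.
by rewrite /= fpset_eval_act IH -freeprod_mulE.
Qed.
End NormalForm.

Lemma fpset_map_sq (S T S1 T1 S2 T2 S' T' : choiceType)
    (f : S -> S1) (f' : S1 -> S') (k : S -> S2) (k' : S2 -> S')
    (g : T -> T1) (g' : T1 -> T') (l : T -> T2) (l' : T2 -> T') p :
  (forall s, f' (f s) = k' (k s)) -> (forall s, g' (g s) = l' (l s)) ->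
  fpset_map f' g' (fpset_map f g p) = fpset_map k' l' (fpset_map k l p).
Proof.
move=> fk gl; case: p => [[s t] w]; rewrite /fpset_map /= fk gl; congr (_, _).
by apply: fmap_sq => -[t' s'] /=; rewrite fk gl.
Qed.

Lemma fpset_map_can (S T S' T' : choiceType) (f : S -> S') (g : T -> T') f' g' :
  cancel f f' -> cancel g g' -> cancel (fpset_map f g) (fpset_map f' g').
Proof.
move=> fK gK [[s t] w]; rewrite /fpset_map /= fK gK; congr (_, _).
by rewrite (fmap_comp (h := id)) ?fmap_id // => -[t' s'] /=; rewrite fK gK.
Qed.

Section NormalFormNaturality.
Variables (G H G' H' : groupType) (f : {ghom G -> G'}) (g : {ghom H -> H'}).

Lemma fpset_of_nat x : fpset_of (fp_map f g x) = fpset_map f g (fpset_of x).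
Proof.
pose fg (l : G + H) : G' + H' :=
  match l with inl x => inl (f x) | inr y => inr (g y) end.
have fgE u : fp_map f g (\pi_(freeprod G H) u) = \pi_(freeprod G' H') (map fg u).
  elim: u => [|l u IH]; first exact: gmulf1.
  rewrite -cat1s freeprod_mulE gmulfM IH map_cat freeprod_mulE; congr (_ * _).
  by case: l => s; [exact: fp_map_inl|exact: fp_map_inr].
elim/quotW: x => u; rewrite fgE !fpset_of_pi; elim: u => [|l u IH] /=.
  by rewrite /fpset_map /= !gmulf1.
rewrite IH; move: (fpset_word u) => [[a b] w]; case: l => s /=.
  by rewrite /fpset_map /= gmulfM.
by rewrite /fpset_map /fpset_gen /= !gmulfM gmulfV !fmap_gen /= gmulfM.
Qed.

Lemma fpset_eval_nat p : fpset_eval (fpset_map f g p) = fp_map f g (fpset_eval p).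
Proof.
case: p => [[a b] w]; rewrite /fpset_eval /fpset_map /= !gmulfM.
rewrite fp_map_inl fp_map_inr; congr (_ * _).
set c := fun ba => [~ _, _]; set c' := fun ba => [~ _, _].
apply: (fgroup_ext (f := flift c \o fmap _) (g := fp_map f g \o flift c')) w.
move=> [t s] /=; rewrite fmap_gen !flift_gen /c /c' /= gmulfR.
by rewrite fp_map_inl fp_map_inr.
Qed.
End NormalFormNaturality.

Definition fp_ctr (G H G' H' : groupType) (f : G -> G') (g : H -> H')
    (x : freeprod G H) : freeprod G' H' := fpset_eval (fpset_map f g (fpset_of x)).

(** [fpset_eval] is natural for the morphisms [f'] and [g'], which reduces the claim to the
    retraction identity. *)
Lemma fp_ctr_can (G H G' H' : groupType) (f : G -> G') (g : H -> H')
    (f' : {ghom G' -> G}) (g' : {ghom H' -> H}) :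
  cancel f f' -> cancel g g' -> cancel (fp_ctr f g) (fp_map f' g').
Proof.
by move=> fK gK x; rewrite -fpset_eval_nat fpset_map_can // fpset_evalK.
Qed.

Lemma fp_ctr_sq (G H G1 H1 G2 H2 K L : groupType)
    (f : G -> G1) (f' : {ghom G1 -> K}) (k : {ghom G -> G2}) (k' : G2 -> K)
    (g : H -> H1) (g' : {ghom H1 -> L}) (l : {ghom H -> H2}) (l' : H2 -> L) x :
  (forall s, f' (f s) = k' (k s)) -> (forall s, g' (g s) = l' (l s)) ->
  fp_map f' g' (fp_ctr f g x) = fp_ctr k' l' (fp_map k l x).
Proof.
move=> fk gl; rewrite -fpset_eval_nat /fp_ctr fpset_of_nat.
by rewrite (fpset_map_sq _ fk gl).
Qed.

Section FreeProductSection.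
Variables (G H : groupType) (s : {ghom G -> fgroup G}) (t : {ghom H -> fgroup H}).

Definition fp_sec : {ghom freeprod G H -> fgroup (freeprod G H)} :=
  fp_elim (fmap (@fp_inl G H) \o s) (fmap (@fp_inr G H) \o t).

Lemma fp_secK : cancel s (feps G) -> cancel t (feps H) -> cancel fp_sec (feps _).
Proof.
move=> sK tK; apply: (fp_ext (f := feps _ \o fp_sec) (g := idfun)) => x /=.
  by rewrite [fp_sec _]fp_elim_inl /= (feps_nat (@fp_inl G H)) sK.
by rewrite [fp_sec _]fp_elim_inr /= (feps_nat (@fp_inr G H)) tK.
Qed.
End FreeProductSection.

(** * The abelianization of a free product as a direct sum *)

Section AbelianizedFreeProduct.
Local Open Scope ring_scope.
Variables G H : groupType.

Definition abinl : {additive abz G -> abz (freeprod G H)} := abz_map (@fp_inl G H).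
Definition abinr : {additive abz H -> abz (freeprod G H)} := abz_map (@fp_inr G H).
Definition abprl : {additive abz (freeprod G H) -> abz G} :=
  abz_map (fp_elim idfun (@gtriv H G)).
Definition abprr : {additive abz (freeprod G H) -> abz H} :=
  abz_map (fp_elim (@gtriv G H) idfun).

Lemma abz_map_triv (K L : groupType) x : abz_map (@gtriv K L) x = 0.
Proof. by elim/ab_elim: x => x; rewrite /abz_map ab_mapE gmulf1. Qed.

Lemma abinlK : cancel abinl abprl.
Proof. by apply: abz_map_can => x; exact: (fp_elim_inl idfun). Qed.

Lemma abinrK : cancel abinr abprr.
Proof. by apply: abz_map_can => x; exact: (fp_elim_inr _ idfun). Qed.

Lemma abprl_inr y : abprl (abinr y) = 0.
Proof.
rewrite -[RHS](abz_map_triv G y); apply: abz_map_comp => x.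
exact: (fp_elim_inr idfun (@gtriv H G)).
Qed.

Lemma abprr_inl y : abprr (abinl y) = 0.
Proof.
rewrite -[RHS](abz_map_triv H y); apply: abz_map_comp => x.
exact: (fp_elim_inl (@gtriv G H) idfun).
Qed.

(** Both sides are additive, so it suffices to check single letters of a word. *)
Lemma abpr_in x : abinl (abprl x) + abinr (abprr x) = x.
Proof.
elim/ab_elim: x => x; elim/quotW: x => u.
pose q w : abz (freeprod G H) := quo_pi (derived (freeprod G H)) (\pi_(freeprod G H) w).
rewrite -/(q u); elim: u => [|l u IH].
  have -> : q [::] = 0 by rewrite /q gmulf1.
  by rewrite !raddf0 addr0.
have -> : q (l :: u) = q [:: l] + q u.
  by rewrite /q -cat1s freeprod_mulE gmulfM.
rewrite !raddfD addrACA IH; congr (_ + _).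
case: l => s.
  have -> : q [:: inl s] = abinl (quo_pi _ s) by rewrite /= /abz_map ab_mapE.
  by rewrite abinlK abprr_inl raddf0 addr0.
have -> : q [:: inr s] = abinr (quo_pi _ s) by rewrite /= /abz_map ab_mapE.
by rewrite abinrK abprl_inr raddf0 add0r.
Qed.
End AbelianizedFreeProduct.

Section AbelianizedFreeProductNaturality.
Local Open Scope ring_scope.
Variables (G H G' H' : groupType) (f : {ghom G -> G'}) (g : {ghom H -> H'}).

Lemma abinl_nat x : abz_map (fp_map f g) (abinl G H x) = abinl G' H' (abz_map f x).
Proof. by apply: abz_map_sq => s; exact: fp_map_inl. Qed.

Lemma abinr_nat x : abz_map (fp_map f g) (abinr G H x) = abinr G' H' (abz_map g x).
Proof. by apply: abz_map_sq => s; exact: fp_map_inr. Qed.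

Lemma abprl_nat x : abprl G' H' (abz_map (fp_map f g) x) = abz_map f (abprl G H x).
Proof.
rewrite -{1}[x]abpr_in raddfD /= abinl_nat abinr_nat raddfD /=.
by rewrite abinlK abprl_inr addr0.
Qed.

Lemma abprr_nat x : abprr G' H' (abz_map (fp_map f g) x) = abz_map g (abprr G H x).
Proof.
rewrite -{1}[x]abpr_in raddfD /= abinl_nat abinr_nat raddfD /=.
by rewrite abinrK abprr_inl add0r.
Qed.

Lemma abpr_ext (x y : abz (freeprod G H)) :
  abprl G H x = abprl G H y -> abprr G H x = abprr G H y -> x = y.
Proof. by move=> xl xr; rewrite -[x]abpr_in xl xr abpr_in. Qed.
End AbelianizedFreeProductNaturality.

Section FreeProductSquare.
Variables Y1 Y2 : asquare.

Definition fpsq_obj c q : groupType := freeprod (Y1 c q) (Y2 c q).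

Definition fpsq_face c q i : {ghom fpsq_obj c q.+1 -> fpsq_obj c q} :=
  fp_map (aface Y1 c q i) (aface Y2 c q i).

Definition fpsq_map e q : {ghom fpsq_obj (src e) q -> fpsq_obj (tgt e) q} :=
  fp_map (amap Y1 e q) (amap Y2 e q).

Definition fpsq_ctr c q : fpsq_obj c q -> fpsq_obj c q.+1 :=
  fp_ctr (@actr Y1 c q) (@actr Y2 c q).

Definition fpsq_sec c q : {ghom fpsq_obj c q.+1 -> fgroup (fpsq_obj c q.+1)} :=
  fp_sec (asec Y1 c q) (asec Y2 c q).

Fact fpsq_face_face c q (i j : nat) x : i < j <= q.+1 ->
  fpsq_face c q i (fpsq_face c q.+1 j x) = fpsq_face c q j.-1 (fpsq_face c q.+1 i x).
Proof. by move=> ij; apply: fp_map_sq => s; exact: aface_aface. Qed.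

Fact fpsq_map_face e q i x : i <= q ->
  fpsq_map e q (fpsq_face _ q i x) = fpsq_face _ q i (fpsq_map e q.+1 x).
Proof. by move=> iq; apply: fp_map_sq => s; exact: amap_face. Qed.

Fact fpsq_comm q x :
  fpsq_map eg q (fpsq_map eb q x) = fpsq_map ed q (fpsq_map ea q x).
Proof. by apply: fp_map_sq => s; exact: amap_comm. Qed.

Fact fpsq_face0_ctr c q x : fpsq_face c q 0 (fpsq_ctr x) = x.
Proof. by apply: fp_ctr_can => s; exact: aface0_actr. Qed.

Fact fpsq_faceS_ctr c q (i : nat) x : i <= q ->
  fpsq_face c q.+1 i.+1 (fpsq_ctr x) = fpsq_ctr (fpsq_face c q i x).
Proof. by move=> iq; apply: fp_ctr_sq => s; exact: afaceS_actr. Qed.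

Fact fpsq_secK c q : cancel (fpsq_sec c q) (feps _).
Proof. by apply: fp_secK; exact: asecK. Qed.

Fact fpsq_surj q (y : abz (fpsq_obj cS q.+1)) :
  exists x, abz_map (fpsq_map eg q.+1) x = y.
Proof.
have [x1 e1] := amap_surj (abprl _ _ y); have [x2 e2] := amap_surj (abprr _ _ y).
exists (abinl _ _ x1 + abinr _ _ x2)%R.
by rewrite raddfD /= abinl_nat abinr_nat e1 e2 abpr_in.
Qed.

Fact fpsq_pullback q (y : abz (fpsq_obj cL q.+1)) (z : abz (fpsq_obj cR q.+1)) :
  abz_map (fpsq_map eg q.+1) z = abz_map (fpsq_map ed q.+1) y ->
  exists2 x, abz_map (fpsq_map ea q.+1) x = y & abz_map (fpsq_map eb q.+1) x = z.
Proof.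
move=> zy; have := congr1 (abprl _ _) zy; have := congr1 (abprr _ _) zy.
rewrite !abprr_nat !abprl_nat.
move=> /amap_pullback[x2 a2 b2] /amap_pullback[x1 a1 b1].
exists (abinl _ _ x1 + abinr _ _ x2)%R.
  by rewrite raddfD /= abinl_nat abinr_nat a1 a2 abpr_in.
by rewrite raddfD /= abinl_nat abinr_nat b1 b2 abpr_in.
Qed.

Definition fpsq : asquare := ASquare fpsq_face_face fpsq_map_face fpsq_comm
  fpsq_face0_ctr fpsq_faceS_ctr fpsq_secK fpsq_surj fpsq_pullback.

Local Open Scope ring_scope.

Let map0P e q (x : abz (fpsq_obj (src e) q)) : abz_map (fpsq_map e q) x = 0 <->
  abz_map (amap Y1 e q) (abprl _ _ x) = 0 /\ abz_map (amap Y2 e q) (abprr _ _ x) = 0.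
Proof.
rewrite -(abprl_nat (amap Y1 e q) (amap Y2 e q)).
rewrite -(abprr_nat (amap Y1 e q) (amap Y2 e q)).
split=> [->|[xl xr]]; first by rewrite !raddf0.
by apply: abpr_ext; rewrite raddf0.
Qed.

Lemma fpsq_cycle (t : abz (fpsq cK 2%N)) :
  @acycle fpsq t <-> @acycle Y1 (abprl _ _ t) /\ @acycle Y2 (abprr _ _ t).
Proof.
split=> [[/map0P[ta1 ta2] /map0P[tb1 tb2] dt]|[[ta1 tb1 dt1] [ta2 tb2 dt2]]].
  split; split=> //.
    by have := congr1 (abprl _ _) dt; rewrite !abprl_nat.
  by have := congr1 (abprr _ _) dt; rewrite !abprr_nat.
split; [exact/map0P|exact/map0P|].
by apply: abpr_ext; [rewrite !abprl_nat|rewrite !abprr_nat].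
Qed.

Lemma fpsq_bound (t : abz (fpsq cK 2%N)) :
  @abound fpsq t <-> @abound Y1 (abprl _ _ t) /\ @abound Y2 (abprr _ _ t).
Proof.
split=> [[u [/map0P[ua1 ua2] /map0P[ub1 ub2] ->]]|
         [[u1 [ua1 ub1 du1]] [u2 [ua2 ub2 du2]]]].
  split; [exists (abprl _ _ u)|exists (abprr _ _ u)]; split=> //.
    by rewrite raddfD raddfB /= !abprl_nat.
  by rewrite raddfD raddfB /= !abprr_nat.
pose u : abz (fpsq_obj cK 3%N) := abinl _ _ u1 + abinr _ _ u2.
have ul : abprl _ _ u = u1 by rewrite raddfD /= abinlK abprl_inr addr0.
have ur : abprr _ _ u = u2 by rewrite raddfD /= abinrK abprr_inl add0r.
exists u; split; [by apply/map0P; rewrite ul ur|by apply/map0P; rewrite ul ur|].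
apply: abpr_ext.
  by rewrite du1 raddfD raddfB /= !abprl_nat ul.
by rewrite du2 raddfD raddfB /= !abprr_nat ur.
Qed.

Lemma presents_fpsq (H1 H2 : groupType) :
  presents H1 (@acycle Y1) (@abound Y1) -> presents H2 (@acycle Y2) (@abound Y2) ->
  presents (H1 * H2)%type (@acycle fpsq) (@abound fpsq).
Proof.
case=> k1 [kZ1 kM1 kI1 kS1] [k2 [kZ2 kM2 kI2 kS2]].
have [k kl kr] : exists2 k : (H1 * H2)%type -> abz (fpsq cK 2%N),
    forall a, abprl _ _ (k a) = k1 a.1 & forall a, abprr _ _ (k a) = k2 a.2.
  exists (fun a => abinl _ _ (k1 a.1) + abinr _ _ (k2 a.2)) => a.
    by rewrite raddfD /= abinlK abprl_inr addr0.
  by rewrite raddfD /= abinrK abprr_inl add0r.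
exists k; split=> [a|a b|a b|t].
- by apply/fpsq_cycle; rewrite kl kr.
- apply/fpsq_bound; rewrite !(raddfB (abprl _ _)) !(raddfB (abprr _ _)).
  rewrite (raddfD (abprl _ _)) (raddfD (abprr _ _)) !kl !kr.
  by split; [exact: kM1|exact: kM2].
- move=> /fpsq_bound; rewrite !raddfB /= !kl !kr => -[/kI1 ab1 /kI2 ab2].
  by case: a b ab1 ab2 => [a1 a2] [b1 b2] /= -> ->.
move=> /fpsq_cycle[/kS1[a1 Ba1] /kS2[a2 Ba2]]; exists (a1, a2).
by apply/fpsq_bound; rewrite !raddfB /= !kl !kr.
Qed.
End FreeProductSquare.

(** * Quotients of free products by normal closures *)

Section KernelNormal.
Variables (G H : groupType) (f : {ghom G -> H}).

HB.instance Definition _ := GroupClosed.on (kernel f).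

Fact kernelJ x y : x \in kernel f -> x ^ y \in kernel f.
Proof. by move=> /kernelP fx; apply/kernelP; rewrite gmulfJ fx conj1g. Qed.

HB.instance Definition _ := isConjClosed.Build G (kernel f) kernelJ.
End KernelNormal.

Lemma quo_pi1 (G : groupType) (N : normalClosed G) x : x \in N -> quo_pi N x = 1.
Proof. by move=> Nx; apply/quo_eqP; rewrite divg1. Qed.

Section QuotientOfFreeProduct.
Variables (G H : groupType) (M : normalClosed G) (N : normalClosed H).

(** The larger subgroups serve the corner S, where the quotients are by the products MN. *)
Lemma freeprod_ncl_trivial (M' : normalClosed G) (N' : normalClosed H) x :
  {subset M <= M'} -> {subset N <= N'} -> x \in freeprod_ncl M N ->
  fp_map (quo_pi M') (quo_pi N') x = 1.
Proof.
move=> MM' NN' /nclosureP/(_ (kernel (fp_map (quo_pi M') (quo_pi N')))) Kx.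
apply/kernelP/Kx => _ /asboolP[w ->]; apply/kernelP.
apply: (fp_ext (f := fp_map (quo_pi M') (quo_pi N') \o freeprod_incl M N)
               (g := @gtriv _ _)) w => -[x' Mx] /=.
  by rewrite [freeprod_incl _ _ _]fp_elim_inl fp_map_inl /= quo_pi1 ?gmulf1 ?MM'.
by rewrite [freeprod_incl _ _ _]fp_elim_inr fp_map_inr /= quo_pi1 ?gmulf1 ?NN'.
Qed.

Lemma freeprod_ncl_inl x : x \in M -> fp_inl H x \in freeprod_ncl M N.
Proof.
move=> Mx; apply/nclosureP => P; apply; apply/asboolP.
by exists (fp_inl _ (Subgrp Mx)); rewrite [RHS]fp_elim_inl.
Qed.

Lemma freeprod_ncl_inr x : x \in N -> fp_inr G x \in freeprod_ncl M N.
Proof.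
move=> Nx; apply/nclosureP => P; apply; apply/asboolP.
by exists (fp_inr _ (Subgrp Nx)); rewrite [RHS]fp_elim_inr.
Qed.

Variable P : normalClosed (freeprod G H).
Hypothesis P1 : forall x, x \in P -> fp_map (quo_pi M) (quo_pi N) x = 1.
Hypothesis Pl : forall x, x \in M -> fp_inl H x \in P.
Hypothesis Pr : forall x, x \in N -> fp_inr G x \in P.

(** [P] enters only through the three hypotheses, so that one isomorphism covers the normal closures
    at L and R and their product at S. *)
Definition quo_fp : {ghom quo P -> freeprod (quo M) (quo N)} := quo_lift P1.

Lemma quo_fp_pi x : quo_fp (quo_pi P x) = fp_map (quo_pi M) (quo_pi N) x.
Proof. exact: quo_liftE. Qed.

Fact fp_quo_l x : x \in M -> (quo_pi P \o @fp_inl G H) x = 1.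
Proof. by move=> Mx; apply: quo_pi1; exact: Pl. Qed.

Fact fp_quo_r x : x \in N -> (quo_pi P \o @fp_inr G H) x = 1.
Proof. by move=> Nx; apply: quo_pi1; exact: Pr. Qed.

Definition fp_quo : {ghom freeprod (quo M) (quo N) -> quo P} :=
  fp_elim (quo_lift fp_quo_l) (quo_lift fp_quo_r).

Lemma quo_elim (K : groupType) (L : normalClosed K) (Q : quo L -> Prop) :
  (forall x, Q (quo_pi L x)) -> forall a, Q a.
Proof. by move=> IH; elim/quotW. Qed.

Lemma fp_quo_inl x : fp_quo (fp_inl _ (quo_pi M x)) = quo_pi P (fp_inl H x).
Proof. by rewrite [LHS]fp_elim_inl [LHS]quo_liftE. Qed.

Lemma fp_quo_inr x : fp_quo (fp_inr _ (quo_pi N x)) = quo_pi P (fp_inr G x).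
Proof. by rewrite [LHS]fp_elim_inr [LHS]quo_liftE. Qed.

Lemma quo_fpK : cancel quo_fp fp_quo.
Proof.
elim/quo_elim => x; rewrite quo_fp_pi.
apply: (fp_ext (f := fp_quo \o fp_map (quo_pi M) (quo_pi N)) (g := quo_pi P)) x => x /=.
  by rewrite fp_map_inl fp_quo_inl.
by rewrite fp_map_inr fp_quo_inr.
Qed.

Lemma fp_quoK : cancel fp_quo quo_fp.
Proof.
apply: (fp_ext (f := quo_fp \o fp_quo) (g := idfun)); elim/quo_elim => x /=.
  by rewrite fp_quo_inl quo_fp_pi fp_map_inl.
by rewrite fp_quo_inr quo_fp_pi fp_map_inr.
Qed.
End QuotientOfFreeProduct.

Section AugmentationOfFreeProduct.
Variables (G1 G2 : groupType) (M1 N1 : normalClosed G1) (M2 N2 : normalClosed G2).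

Local Notation M := (freeprod_ncl M1 M2).
Local Notation N := (freeprod_ncl N1 N2).

Fact nprod_ncl_trivial x : x \in nprod M N ->
  fp_map (quo_pi (nprod M1 N1)) (quo_pi (nprod M2 N2)) x = 1.
Proof.
move=> /nprodP[m [n [Mm Nn ->]]]; rewrite gmulfM.
rewrite (freeprod_ncl_trivial (@sub_nprodl _ M1 N1) (@sub_nprodl _ M2 N2) Mm).
rewrite (freeprod_ncl_trivial (@sub_nprodr _ M1 N1) (@sub_nprodr _ M2 N2) Nn).
by rewrite mulg1.
Qed.

Fact nprod_ncl_inl x : x \in nprod M1 N1 -> fp_inl G2 x \in nprod M N.
Proof.
move=> /nprodP[m [n [Mm Nn ->]]]; rewrite gmulfM; apply: gpredM.
  exact/sub_nprodl/freeprod_ncl_inl.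
exact/sub_nprodr/freeprod_ncl_inl.
Qed.

Fact nprod_ncl_inr x : x \in nprod M2 N2 -> fp_inr G1 x \in nprod M N.
Proof.
move=> /nprodP[m [n [Mm Nn ->]]]; rewrite gmulfM; apply: gpredM.
  exact/sub_nprodl/freeprod_ncl_inr.
exact/sub_nprodr/freeprod_ncl_inr.
Qed.

Fact ncl_trivial (P1 : normalClosed G1) (P2 : normalClosed G2) x :
  x \in freeprod_ncl P1 P2 -> fp_map (quo_pi P1) (quo_pi P2) x = 1.
Proof. exact: freeprod_ncl_trivial. Qed.

Definition cgrp_fp c :
    {ghom cgrp M N c -> freeprod (cgrp M1 N1 c) (cgrp M2 N2 c)} :=
  match c return {ghom cgrp M N c -> freeprod (cgrp M1 N1 c) (cgrp M2 N2 c)} with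
  | cK => idfun
  | cL => quo_fp (@ncl_trivial N1 N2)
  | cR => quo_fp (@ncl_trivial M1 M2)
  | cS => quo_fp nprod_ncl_trivial
  end.

Definition fp_cgrp c :
    {ghom freeprod (cgrp M1 N1 c) (cgrp M2 N2 c) -> cgrp M N c} :=
  match c return {ghom freeprod (cgrp M1 N1 c) (cgrp M2 N2 c) -> cgrp M N c} with
  | cK => idfun
  | cL => fp_quo (@freeprod_ncl_inl _ _ N1 N2) (@freeprod_ncl_inr _ _ N1 N2)
  | cR => fp_quo (@freeprod_ncl_inl _ _ M1 M2) (@freeprod_ncl_inr _ _ M1 M2)
  | cS => fp_quo nprod_ncl_inl nprod_ncl_inr
  end.

Fact cgrp_fpK c : cancel (cgrp_fp c) (fp_cgrp c).
Proof. by case: c => //; exact: quo_fpK. Qed.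

Fact fp_cgrpK c : cancel (fp_cgrp c) (cgrp_fp c).
Proof. by case: c => //; exact: fp_quoK. Qed.

Fact cgrp_fp_proj e x : cgrp_fp (tgt e) (cproj M N e x) =
  fp_map (cproj M1 N1 e) (cproj M2 N2 e) (cgrp_fp (src e) x).
Proof.
have proj_map (A B : groupType) (P P' : normalClosed A) (Q Q' : normalClosed B)
    (PP' : {subset P <= P'}) (QQ' : {subset Q <= Q'}) y :
    fp_map (quo_proj PP') (quo_proj QQ') (fp_map (quo_pi P) (quo_pi Q) y) =
    fp_map (quo_pi P') (quo_pi Q') y.
  apply: (fp_ext (f := fp_map (quo_proj PP') (quo_proj QQ') \o
    fp_map (quo_pi P) (quo_pi Q)) (g := fp_map (quo_pi P') (quo_pi Q'))) y => y /=.
    by rewrite !fp_map_inl /= quo_projE.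
  by rewrite !fp_map_inr /= quo_projE.
case: e x => x; try exact: quo_fp_pi.
  by elim/quo_elim: x => x; rewrite /= quo_projE !quo_fp_pi proj_map.
by elim/quo_elim: x => x; rewrite /= quo_projE !quo_fp_pi proj_map.
Qed.
End AugmentationOfFreeProduct.

Theorem theorem3p6 (G1 G2 : groupType)
    (M1 N1 : normalClosed G1) (M2 N2 : normalClosed G2)
    (X1 : res_square M1 N1) (X2 : res_square M2 N2)
    (X : res_square (freeprod_ncl M1 M2) (freeprod_ncl N1 N2)) :
  group_iso (schur_multiplier X)
       (schur_multiplier X1 * schur_multiplier X2)%type.
Proof.
apply: (@iso_of_augmentation_iso (rsquare X) (fpsq (rsquare X1) (rsquare X2))
  (@cgrp_fp _ _ M1 N1 M2 N2) (@fp_cgrp _ _ M1 N1 M2 N2)).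
- exact: cgrp_fpK.
- exact: fp_cgrpK.
- exact: cgrp_fp_proj.
- exact: presents_schur.
exact/presents_fpsq/presents_schur/presents_schur.
Qed.
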